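(* Let $V\in L^\infty(\mathbb R;\mathbb R)$ with $|V(x)|\to 0$ as $|x|\to\infty$, and consider the $\lambda$-nonlinear eigenvalue problem $$-\phi''+(1-\lambda^2)\phi=-(1-\lambda)V\phi,\qquad \phi\in H^1(\mathbb R)\setminus\{0\},\ \lambda\in\mathbb R. \qquad (\ast)$$ Assume that the negative part $V^{(-)}(x)=\max\{0,-V(x)\}$ satisfies $\|V^{(-)}\|_{L^\infty(\mathbb R)}\leq 1$. Then: (a) For each $j\in N_-^0$ there exists a unique $\beta_j\in(0,1]$ such that $\beta_j=-\frac{1}{\mu_j(\beta_j)}\bigl(2+\frac{1}{\mu_j(\beta_j)}\bigr)$. (b) The set of eigenvalues of $(\ast)$ lying in $(-1,1)$ is $\{\lambda_j:=1+\frac{1}{\mu_j(\beta_j)}\,:\, j\in N_-^0\}\subset(-1,1)$, and the eigenspace of $(\ast)$ for $\lambda_j$ coincides with the eigenspace of the operator $K_{\beta_j}$ associated with its eigenvalue $\mu_j(\beta_j)$. (c) $(\lambda_j)_{j\in N_-^0}$ is non-increasing and $0<\lambda_j+1\leq\|V^{(-)}\|_{L^\infty}$ for all $j\in N_-^0$.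
   Context: For $\beta>0$ let $K_\beta=(-\partial_x^2+\beta)^{-1}K:H^1(\mathbb R)\to H^1(\mathbb R)$, where $K:H^1(\mathbb R)\to L^2(\mathbb R)$, $Ku=Vu$. Equip $H^1(\mathbb R)$ with the inner product $\langle u,v\rangle_\beta=\langle u',v'\rangle_{L^2}+\beta\langle u,v\rangle_{L^2}$; then $K_\beta$ is symmetric and compact. Let $\{\mu_j(\beta)\}_{j\in N_-}\subset(-\infty,0)$ be all its negative eigenvalues (with multiplicity), ordered so that $|\mu_1(\beta)|\geq|\mu_2(\beta)|\geq\cdots>0$. The index set $N_-$ (which may be $\mathbb N$, finite, or empty) is independent of $\beta$, and each $\mu_j:(0,\infty)\to(-\infty,0)$ is strictly increasing and continuous, so $\mu_j(0_+)=\lim_{\beta\to0_+}\mu_j(\beta)\in[-\infty,0)$ exists. Define $N_-^0:=\{j\in N_-: \mu_j(0_+)<-\tfrac12\}$. *)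

(* Defs.v *)
From HB Require Import structures.
From mathcomp Require Import all_boot all_order all_algebra.
From mathcomp Require Import all_classical all_reals all_analysis.
From mathcomp Require Import ess_sup_inf.
Set Implicit Arguments. Unset Strict Implicit. Unset Printing Implicit Defensive.
Import Order.TTheory GRing.Theory Num.Theory.
Import numFieldNormedType.Exports.
Local Open Scope classical_set_scope.
Local Open Scope ring_scope.

Section defs.
Variable R : realType.
Local Notation mu := (@lebesgue_measure R).

Definition L2 (u : R -> R) : Prop :=
  measurable_fun setT u /\ (\int[mu]_x ((u x) ^+ 2)%:E < +oo)%E.

Definition test_fun (phi : R -> R) : Prop :=
  (forall x, derivable phi x 1) /\ continuous (derive1 phi) /\
  exists M : R, forall x, M < `|x| -> phi x = 0.

Definition weak_deriv (u g : R -> R) : Prop :=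
  forall phi, test_fun phi ->
    \int[mu]_x (u x * (derive1 phi) x) = - \int[mu]_x (g x * phi x).

Definition H1 (u : R -> R) : Prop :=
  L2 u /\ exists g, L2 g /\ weak_deriv u g.

(* <u,v>_beta = <u',v'> + beta <u,v>, with u', v' the weak derivatives *)
Definition ip_beta (beta : R) (u du v dv : R -> R) : R :=
  \int[mu]_x (du x * dv x) + beta * \int[mu]_x (u x * v x).

(* K_beta u = w, i.e. w = (-d^2 + beta)^{-1} (V u): w in H^1 is the weak
   solution of -w'' + beta w = V u *)
Definition Kbeta_eq (V : R -> R) (beta : R) (u w : R -> R) : Prop :=
  H1 u /\ H1 w /\
  forall dw, L2 dw -> weak_deriv w dw ->
  forall v dv, H1 v -> L2 dv -> weak_deriv v dv ->
    ip_beta beta w dw v dv = \int[mu]_x (V x * u x * v x).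

(* u lies in the eigenspace of K_beta for the eigenvalue m (u = 0 allowed) *)
Definition Keig (V : R -> R) (beta m : R) (u : R -> R) : Prop :=
  Kbeta_eq V beta u (fun x => m * u x).

Definition ae_lin_indep (j : nat) (u : 'I_j -> R -> R) : Prop :=
  forall c : 'I_j -> R,
    (\forall x \ae mu, \sum_(i < j) c i * u i x = 0) -> forall i, c i = 0.

(* K_beta has at least j negative eigenvalues <= t, counted with multiplicity *)
Definition neg_count_ge (V : R -> R) (beta t : R) (j : nat) : Prop :=
  exists u : 'I_j -> R -> R, ae_lin_indep u /\
    forall i, exists m, m < 0 /\ m <= t /\ Keig V beta m (u i).

(* mu_j(beta): the j-th (j >= 1) negative eigenvalue of K_beta, the negative
   eigenvalues being listed with multiplicity and |mu_1| >= |mu_2| >= ... *)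
Definition mu_j (V : R -> R) (j : nat) (beta : R) : R :=
  inf [set t | t < 0 /\ neg_count_ge V beta t j].

Definition N_minus (V : R -> R) (j : nat) : Prop :=
  (0 < j)%N /\ forall beta, 0 < beta -> exists t, t < 0 /\ neg_count_ge V beta t j.

Definition mu_j0 (V : R -> R) (j : nat) : \bar R :=
  lim ((fun b => (mu_j V j b)%:E) @ 0^'+).

Definition N_minus0 (V : R -> R) : set nat :=
  [set j | N_minus V j /\ (mu_j0 V j < (- (1/2))%:E)%E].

Definition solves_ast (V : R -> R) (l : R) (phi : R -> R) : Prop :=
  H1 phi /\
  forall dphi, L2 dphi -> weak_deriv phi dphi ->
  forall v dv, H1 v -> L2 dv -> weak_deriv v dv ->
    \int[mu]_x (dphi x * dv x) + (1 - l ^+ 2) * \int[mu]_x (phi x * v x)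
    = - ((1 - l) * \int[mu]_x (V x * phi x * v x)).

Definition ae_zero (phi : R -> R) : Prop := \forall x \ae mu, phi x = 0.

Definition Vneg (V : R -> R) (x : R) : R := Num.max 0 (- V x).

End defs.

(* Main.v *)
(* Write q_beta(u,v) = <u',v'> + beta <u,v> and b(u,v) = int V u v, so that
   K_beta u = m u means b(u,.) = m q_beta(u,.).  Since V vanishes at infinity, b
   is compact with respect to q_beta, and minimizing b/q_beta on the
   q_beta-orthogonal complement of the eigenfunctions already found produces the
   negative eigenvalues one after the other.  This gives the min-max principle:
   mu_j(beta) <= t < 0 iff b <= t q_beta on some j-dimensional subspace.  As
   q_beta is increasing and q_beta / beta decreasing in beta, mu_j is
   nondecreasing and beta mu_j(beta) nonincreasing, whence continuity.  Finally
   solutions of the nonlinear problem for l < 1 are the eigenfunctions of K_beta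
   with beta = 1 - l^2 and eigenvalue m = -1/(1-l), and -beta m <= ||V^(-)|| <= 1
   selects the root l <= 0 of beta = -(1/m)(2+1/m). *)
Require Import Defs.
From HB Require Import structures.
From mathcomp Require Import all_boot all_order all_algebra.
From mathcomp Require Import all_classical all_reals all_analysis.
From mathcomp Require Import ess_sup_inf measurable_realfun ring lra.
Set Implicit Arguments. Unset Strict Implicit. Unset Printing Implicit Defensive.
Import Order.TTheory GRing.Theory Num.Theory.
Import numFieldNormedType.Exports.
Local Open Scope classical_set_scope.
Local Open Scope ring_scope.

(** * Minimization of one bilinear form relative to another *)

(** On the whole line H^1 does not embed compactly into L^2, so compactness has to come from the
    decay of [V] together with the 1/2-Hölder bound for H^1 functions on a bounded interval. It is
    phrased without weak convergence: along every ultrafilter, [b] of the differences of a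
    [q]-bounded sequence is eventually at least [- eps]. For a minimizing sequence with negative
    infimum this already forces convergence in [q]. The resolvent is never constructed; [K_beta]
    enters only through the two forms. These live on pairs (function, weak derivative) of genuine
    functions rather than classes modulo null sets, so [q] is merely semidefinite and independence
    is understood modulo its kernel. No continuous representative is chosen either: point values are
    used at Lebesgue points only. Continuity of the branches is used in quantitative form: the two
    monotonicities make [- 1 / mu_j] Lipschitz on compact subintervals, and the intermediate value
    theorem then yields [beta_j]. *)

Record sym_bilinear (R : realType) (H : lmodType R) (f : H -> H -> R) : Prop :=
  SymBilinear {
    formC : forall u v, f u v = f v u;
    formDl : forall u v w, f (u + v) w = f u w + f v w;
    formZl : forall c u w, f (c *: u) w = c * f u w }.

Section sym_bilinear_theory.
Context {R : realType} {H : lmodType R} (f : H -> H -> R).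
Hypothesis fB : sym_bilinear f.
Let fC := formC fB. Let fDl := formDl fB. Let fZl := formZl fB.

Lemma formDr u v w : f w (u + v) = f w u + f w v.
Proof. by rewrite fC fDl !(fC _ w). Qed.

Lemma formZr c u w : f w (c *: u) = c * f w u.
Proof. by rewrite fC fZl fC. Qed.

Lemma form0l w : f 0 w = 0.
Proof. by rewrite -(scale0r 0) fZl mul0r. Qed.

Lemma formNl u w : f (- u) w = - f u w.
Proof. by rewrite -scaleN1r fZl mulN1r. Qed.

Lemma formBl u v w : f (u - v) w = f u w - f v w.
Proof. by rewrite fDl formNl. Qed.

Lemma formBr u v w : f w (u - v) = f w u - f w v.
Proof. by rewrite fC formBl !(fC _ w). Qed.

Lemma formNr u w : f w (- u) = - f w u.
Proof. by rewrite fC formNl fC. Qed.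

Lemma form_suml (I : Type) (r : seq I) (P : pred I) (F : I -> H) w :
  f (\sum_(i <- r | P i) F i) w = \sum_(i <- r | P i) f (F i) w.
Proof.
by elim/big_rec2 : _ => [|i y1 y2 _ <-]; rewrite ?form0l// fDl.
Qed.

Lemma form_sumr (I : Type) (r : seq I) (P : pred I) (F : I -> H) w :
  f w (\sum_(i <- r | P i) F i) = \sum_(i <- r | P i) f w (F i).
Proof. by rewrite fC form_suml; apply: eq_bigr => i _; rewrite fC. Qed.

Lemma form_parallelogram u v :
  f (u + v) (u + v) = 2 * f u u + 2 * f v v - f (u - v) (u - v).
Proof. by rewrite !(fDl, formDr, formNl, formNr) (fC v u); ring. Qed.

Lemma form_sqD u v : f (u + v) (u + v) = f u u + 2 * f u v + f v v.
Proof. by rewrite !(fDl, formDr) (fC v u); ring. Qed.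

End sym_bilinear_theory.

Lemma discriminant_le (R : realType) (a b c : R) :
  (forall t, 0 <= a + 2 * t * b + t ^+ 2 * c) -> b ^+ 2 <= a * c.
Proof.
move=> h.
have [c0|c0|c0] := ltgtP c 0.
- have a0 : 0 <= a by have := h 0; rewrite !(mulr0, mul0r, expr0n, addr0)/=.
  exfalso.
  (* The summand 1 makes this [t] at least 1, so [t ^+ 2 * - c] is at least [t] times (2|b| + a +
     1), which exceeds a + 2t|b|. *)
  have /= := h ((2 * `|b| + a + 1) / - c + 1).
  apply/negP; rewrite -ltNge.
  set s := _ / _.
  have hs : s * - c = 2 * `|b| + a + 1 by rewrite /s divfK// oppr_eq0 lt_eqF.
  have sge : 0 <= s by rewrite /s divr_ge0// ?addr_ge0 ?mulr_ge0 ?oppr_ge0// ltW.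
  have := ler_norm b; have := ler_norm (- b); rewrite normrN => h1 h2.
  nra.
- have := h (- b / c).
  have -> : a + 2 * (- b / c) * b + (- b / c) ^+ 2 * c = (a * c - b ^+ 2) / c.
    by field; rewrite gt_eqF.
  by rewrite pmulr_lge0 ?invr_gt0// subr_ge0.
- rewrite c0 mulr0; have [->|b0] := eqVneq b 0; first by rewrite expr0n.
  have := h (- (a + 1) / (2 * b)).
  rewrite c0 mulr0 addr0.
  have -> : a + 2 * (- (a + 1) / (2 * b)) * b = -1 by field.
  by rewrite lerNr oppr0 ler10.
Qed.

(** Nonnegativity is asked only along one line: in [minimizer] this is applied to b - m q, which is
    nonnegative only on an orthogonal complement. *)
Lemma form_CauchySchwarz (R : realType) (H : lmodType R) (f : H -> H -> R) u v :
  sym_bilinear f -> (forall t, 0 <= f (u + t *: v) (u + t *: v)) ->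
  f u v ^+ 2 <= f u u * f v v.
Proof.
move=> fB h; apply: discriminant_le => t.
have := h t; rewrite form_sqD// (formZr fB) (formZl fB) (formZr fB).
by rewrite expr2 !mulrA.
Qed.

Section spectral.
Context {R : realType} {H : lmodType R} (q b : H -> H -> R).

Definition lincomb (k : nat) (c : nat -> R) (f : nat -> H) : H :=
  \sum_(i < k) c i *: f i.

(** [q] vanishes on functions that are zero almost everywhere, so independence is tested by [q] and
    not by equality with 0 in [H]. *)
Definition form_indep (k : nat) (f : nat -> H) : Prop :=
  forall c, q (lincomb k c f) (lincomb k c f) = 0 -> forall i, (i < k)%N -> c i = 0.

(* [b <= t q] on some subspace of dimension [k] (modulo the kernel of [q]) *)
Definition subspace_le (t : R) (k : nat) : Prop :=
  exists f, form_indep k f /\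
    forall c, b (lincomb k c f) (lincomb k c f) <=
              t * q (lincomb k c f) (lincomb k c f).

Definition form_orthonormal (k : nat) (e : nat -> H) : Prop :=
  forall i j, (i < k)%N -> (j < k)%N -> q (e i) (e j) = (i == j)%:R.

Definition form_eigen (m : R) (u : H) : Prop := forall v, b u v = m * q u v.

Hypothesis qB : sym_bilinear q.
Hypothesis bB : sym_bilinear b.
Hypothesis q_ge0 : forall u, 0 <= q u u.
Hypothesis q_complete : forall u : nat -> H,
  (forall n, q (u n.+1 - u n) (u n.+1 - u n) <= 8^-1 ^+ n) ->
  exists v, forall eps : R, 0 < eps -> exists N, forall n, (N <= n)%N ->
    q (u n - v) (u n - v) <= eps.
(** Compactness of the negative part of [b]. A bound from below is what the search for negative
    eigenvalues calls for, and an ultrafilter takes the place of a weakly convergent subsequence. *)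
Hypothesis b_compact : forall u : nat -> H, (forall n, q (u n) (u n) <= 1) ->
  forall F, UltraFilter F -> forall eps : R, 0 < eps ->
  exists A, F A /\ forall n k, A n -> A k ->
    - eps <= b (u n - u k) (u n - u k).
Hypothesis b_bounded : exists C : R, 0 <= C /\ forall u, `|b u u| <= C * q u u.

Lemma lincombS k c f : lincomb k.+1 c f = lincomb k c f + c k *: f k.
Proof. by rewrite /lincomb big_ord_recr. Qed.

Lemma eq_lincomb k c c' f f' :
  (forall i, (i < k)%N -> c i = c' i) -> (forall i, (i < k)%N -> f i = f' i) ->
  lincomb k c f = lincomb k c' f'.
Proof. by move=> cc ff; apply: eq_bigr => i _; rewrite cc ?ff. Qed.

Lemma exists_orthogonal k (f e : nat -> H) :
  exists c : nat -> R, (exists i, (i < k.+1)%N /\ c i != 0) /\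
    forall j, (j < k)%N -> q (lincomb k.+1 c f) (e j) = 0.
Proof.
pose A := \matrix_(i < k.+1, j < k) q (f i) (e j).
have rk : (kermx A != 0).
  rewrite -mxrank_eq0 mxrank_ker -lt0n subn_gt0.
  by rewrite (leq_ltn_trans (rank_leq_col A)).
have /rowV0Pn[r] := rk.
rewrite sub_kermx => /eqP rA /eqP r0.
have [i ri] : exists i, r 0 i != 0.
  apply: contrapT => /forallNP h; apply: r0.
  by apply/rowP => i; rewrite mxE; apply/eqP/negPn/negP => /(h i).
exists (fun n => if insub n is Some i then r 0 i else 0); split.
  by exists i; split => //; rewrite valK.
move=> j jk; rewrite /lincomb (form_suml qB).
have /rowP/(_ (Ordinal jk)) := rA.
rewrite !mxE; apply: etrans; apply: eq_bigr => l _.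
by rewrite valK (formZl qB) !mxE.
Qed.

Definition orth (k : nat) (e : nat -> H) (w : H) := forall j, (j < k)%N -> q w (e j) = 0.

Lemma subspace_leS t k : subspace_le t k.+1 -> subspace_le t k.
Proof.
move=> [f [fi fb]]; exists f.
pose ext (c : nat -> R) i := if (i < k)%N then c i else 0.
have extE c : lincomb k.+1 (ext c) f = lincomb k c f.
  rewrite lincombS {2}/ext ltnn scale0r addr0.
  by apply: eq_lincomb => // i ik; rewrite /ext ik.
split=> [c|c]; last by rewrite -extE.
rewrite -extE => /fi h i ik.
by have := h i; rewrite /ext ik; apply; exact: ltnW.
Qed.

Lemma subspace_le_widen t k k' : (k <= k')%N -> subspace_le t k' -> subspace_le t k.
Proof.
by move=> /subnK <-; elim: (k' - k)%N => // d IH /subspace_leS; exact: IH.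
Qed.

Lemma subspace_le_orth t k e : subspace_le t k.+1 ->
  exists w, orth k e w /\ 0 < q w w /\ b w w <= t * q w w.
Proof.
move=> [f [fi fb]]; have [c [[i [ik ci]] co]] := exists_orthogonal k f e.
exists (lincomb k.+1 c f); split => //; split => //.
rewrite lt_neqAle q_ge0 andbT; apply/eqP => /esym /fi /(_ _ ik) /eqP.
by rewrite (negbTE ci).
Qed.

(** Direct method on the [q]-unit sphere of the complement of [e]. Since [t < 0] the infimum [m] is
    negative, and this is what makes a minimizing sequence converge strongly. *)
Lemma minimizer k e ms (t : R) :
  form_orthonormal k e -> (forall i, (i < k)%N -> form_eigen (ms i) (e i)) ->
  (exists w, orth k e w /\ 0 < q w w /\ b w w <= t * q w w) -> t < 0 ->
  exists u m, [/\ q u u = 1, orth k e u, form_eigen m u &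
    forall w, orth k e w -> m * q w w <= b w w].
Proof.
move=> eo ee [w0 [w0o [w0q w0b]]] t0.
have [C [C0 bC]] := b_bounded.
pose S := [set x | exists w, [/\ orth k e w, q w w = 1 & x = b w w]].
have orthZ c w : orth k e w -> orth k e (c *: w).
  by move=> wo j jk; rewrite (formZl qB) wo// mulr0.
have orthD v w : orth k e v -> orth k e w -> orth k e (v + w).
  by move=> vo wo j jk; rewrite (formDl qB) wo// vo// addr0.
have orthB v w : orth k e v -> orth k e w -> orth k e (v - w).
  by move=> vo wo j jk; rewrite (formBl qB) wo// vo// subr0.
have normalize w : orth k e w -> 0 < q w w -> S (b w w / q w w).
  move=> wo wq; exists ((Num.sqrt (q w w))^-1 *: w); split; first exact: orthZ.
    rewrite (formZl qB) (formZr qB) mulrA -expr2 exprVn sqr_sqrtr ?mulVf// gt_eqF//.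
  by rewrite (formZl bB) (formZr bB) mulrA -expr2 exprVn sqr_sqrtr ?q_ge0// mulrC.
have Sn0 : S !=set0 by exists (b w0 w0 / q w0 w0); exact: normalize.
have Slb : has_lbound S.
  exists (- C) => _ [w [_ wq ->]].
  by have := bC w; rewrite wq mulr1 ler_norml => /andP[].
have Sinf : has_inf S by [].
pose m := inf S.
have mt : m <= t.
  apply: (@le_trans _ _ (b w0 w0 / q w0 w0)); last by rewrite ler_pdivrMr.
  by apply: ge_inf => //; exact: normalize.
have m0 : m < 0 by exact: le_lt_trans t0.
have mb w : orth k e w -> m * q w w <= b w w.
  move=> wo; have := q_ge0 w; rewrite le_eqVlt => /orP[/eqP wq|wq].
    rewrite -wq mulr0; have := bC w; rewrite -wq mulr0 normr_le0 => /eqP ->//.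
  by rewrite -ler_pdivlMr//; apply: ge_inf => //; exact: normalize.
have /choice[u uP] : forall n : nat, exists v,
    [/\ orth k e v, q v v = 1 & b v v < m + n.+1%:R^-1].
  move=> n.
  have [|_ [v [vo vq ->]] vb] := @inf_adherent _ S n.+1%:R^-1 _ Sinf; first by [].
  by exists v.
have [F [UF ooF]] := @ultraFilterLemma nat \oo _.
(* With d the difference of two terms, the parallelogram law and [mb] for their sum give - m q(d) <=
   2 (errors) - b(d). Compactness bounds - b(d) by half of eta (-m), the two errors of at most an
   eighth contribute the other half. *)
have cauchy eta : 0 < eta -> exists A, F A /\ forall n l, A n -> A l ->
    q (u n - u l) (u n - u l) <= eta.
  move=> eta0.
  have [A [FA Ab]] := @b_compact u (fun n => ltac:(by case: (uP n) => _ -> _)) F UF (eta * - m / 2)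
    ltac:(by rewrite divr_gt0// mulr_gt0// oppr_gt0).
  have [N NP] : exists N : nat, 8 / (eta * - m) < N%:R.
    by exists (Num.truncn (8 / (eta * - m))).+1; rewrite truncnS_gt.
  exists (A `&` [set n | (N <= n)%N]); split.
    apply: filterI => //; apply: ooF; exact: nbhs_infty_ge.
  move=> n l [An Nn] [Al Nl].
  have [no nq nb] := uP n; have [lo lq lb] := uP l.
  have em0 : 0 < eta * - m by rewrite mulr_gt0// oppr_gt0.
  have invN (i : nat) : (N <= i)%N -> i.+1%:R^-1 <= (eta * - m) / 8.
    move=> Ni; rewrite -[leRHS]invf_div lef_pV2 ?posrE ?divr_gt0//.
    by rewrite (le_trans (ltW NP))// ler_nat (leq_trans Ni).
  have := Ab _ _ An Al; have := mb _ (orthD _ _ no lo).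
  rewrite (form_parallelogram qB) (form_parallelogram bB) nq lq.
  have := invN _ Nn; have := invN _ Nl.
  move: nb lb; rewrite -/m.
  set bn := b (u n) (u n); set bl := b (u l) (u l).
  set bd := b _ _; set qd := q _ _.
  move: (_ ^-1) => x1; move: (_ ^-1) => x2.
  move=> h1 h2 h3 h4 h5 h6.
  have : (- m) * qd <= (- m) * eta by nra.
  by rewrite ler_pM2l ?oppr_gt0.
have /choice[A AP] : forall i : nat, exists A, F A /\ forall n l, A n -> A l ->
    q (u n - u l) (u n - u l) <= 8^-1 ^+ i.
  by move=> i; apply: cauchy; rewrite exprn_gt0// invr_gt0.
(* An index in this set lies in all of A 0, ..., A i at once, so two consecutive picks share A i and
   differ by at most 8^-i. *)
have FB i : F [set n | (i <= n)%N /\ forall l, (l <= i)%N -> A l n].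
  apply: filterI; first by apply: ooF; exact: nbhs_infty_ge.
  elim: i => [|i IH].
    apply: filterS (proj1 (AP 0%N)) => n An l; rewrite leqn0 => /eqP -> //.
  apply: filterS (filterI IH (proj1 (AP i.+1))) => n [h An] l.
  by rewrite leq_eqVlt ltnS => /orP[/eqP ->//|/h].
have /choice[s sP] : forall i, exists n,
    (i <= n)%N /\ forall l, (l <= i)%N -> A l n.
  by move=> i; exact: filter_ex (FB i).
have sq i : q (u (s i.+1) - u (s i)) (u (s i.+1) - u (s i)) <= 8^-1 ^+ i.
  apply: (proj2 (AP i)); first by apply: (proj2 (sP i.+1)); exact: leqnSn.
  exact: (proj2 (sP i)).
have [v vP] := q_complete (u := u \o s) sq.
have vo : orth k e v.
  move=> j jk; apply/eqP; rewrite -sqrf_eq0; apply/eqP/le_anti.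
  rewrite sqr_ge0 andbT; apply/ler_addgt0Pl => eps eps0; rewrite addr0.
  have [N NP] := vP _ eps0.
  apply: le_trans (NP N (leqnn _)) => /=.
  have [uo _ _] := uP (s N).
  have -> : q v (e j) = - q (u (s N) - v) (e j).
    by rewrite (formBl qB) uo// sub0r opprK.
  rewrite sqrrN -[leRHS]mulr1.
  have <- : q (e j) (e j) = 1 by rewrite eo// eqxx.
  exact: form_CauchySchwarz.
pose p x y := b x y - m * q x y.
have pB : sym_bilinear p.
  split=> *; rewrite /p.
  - by rewrite (formC bB) (formC qB).
  - by rewrite (formDl bB) (formDl qB); ring.
  - by rewrite (formZl bB) (formZl qB); ring.
have p_ge0 w : orth k e w -> 0 <= p w w by move=> /mb; rewrite subr_ge0.
(* The limit is not 0: the parallelogram law with q(u) = 1 and q(u - v) <= 1/4 gives q(v) >= 1/4. *)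
have vq : 0 < q v v.
  have [N NP] := vP (1 / 4) ltac:(by []).
  have := NP N (leqnn _) => /=; have [_ q1 _] := uP (s N).
  have := q_ge0 (u (s N) - v - v); have := form_parallelogram qB (u (s N) - v) v.
  rewrite subrK q1 => h1 h2 h3; lra.
(* The parallelogram law for u and u - v, with p(2u - v) >= 0, yields p(v) <= 2 p(u) + 2 p(u - v),
   and both terms are small. *)
have pv : p v v = 0.
  apply: le_anti; rewrite p_ge0// andbT.
  apply/ler_addgt0Pl => eps eps0; rewrite addr0.
  have Cm : 0 < C - m by rewrite subr_gt0 (lt_le_trans m0).
  have [N1 N1P] := vP (eps / (4 * (C - m))) ltac:(by rewrite divr_gt0// mulr_gt0).
  pose N := maxn N1 (Num.truncn (4 / eps)).
  have [uo uq ub] := uP (s N).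
  have d1 := N1P N (leq_maxl _ _).
  have d2 : (s N).+1%:R^-1 <= eps / 4.
    rewrite -[leRHS]invf_div lef_pV2 ?posrE ?divr_gt0//.
    apply: ltW; apply: lt_le_trans (truncnS_gt _) _.
    by rewrite ler_nat ltnS (leq_trans _ (proj1 (sP N)))// leq_maxr.
  have h1 : p (u (s N)) (u (s N)) <= eps / 4.
    by rewrite /p uq mulr1 lerBlDl (le_trans (ltW ub))// lerD2l.
  have h2 : p (u (s N) - v) (u (s N) - v) <= eps / 4.
    apply: (@le_trans _ _ ((C - m) * q (u (s N) - v) (u (s N) - v))).
      rewrite /p mulrBl lerD2r.
      exact: le_trans (ler_norm _) (bC _).
    rewrite -ler_pdivlMl//; apply: le_trans d1 _.
    by rewrite le_eqVlt; apply/orP; left; apply/eqP; field; rewrite gt_eqF.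
  have := p_ge0 _ (orthD _ _ uo (orthB _ _ uo vo)).
  have := form_parallelogram pB (u (s N)) (u (s N) - v).
  have -> : u (s N) - (u (s N) - v) = v by rewrite opprB addrC subrK.
  by move=> -> h3; lra.
(* On the complement, p >= 0 and p(v, v) = 0 give p(v, .) = 0 by Cauchy-Schwarz. The remaining
   component of [w] lies in the span of the [e i], where both forms vanish against [v] because the
   [e i] are eigenvectors. *)
have vm : form_eigen m v.
  move=> w; pose w1 := \sum_(i < k) q w (e i) *: e i.
  have w1q j : (j < k)%N -> q w1 (e j) = q w (e j).
    move=> jk; rewrite (form_suml qB) (bigD1 (Ordinal jk))//=.
    rewrite (formZl qB) eo// eqxx mulr1 big1 ?addr0// => i ij.
    by move: ij; rewrite -val_eqE/= (formZl qB) eo// => /negbTE ->; rewrite mulr0.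
  have w2o : orth k e (w - w1) by move=> j jk; rewrite (formBl qB) w1q// subrr.
  have qvw1 : q v w1 = 0.
    by rewrite (form_sumr qB) big1// => i _; rewrite (formZr qB) vo// mulr0.
  have bvw1 : b v w1 = 0.
    rewrite (form_sumr bB) big1// => i _; rewrite (formZr bB) (formC bB) ee//.
    by rewrite (formC qB _ v) vo// !mulr0.
  have : p v (w - w1) = 0.
    apply/eqP; rewrite -sqrf_eq0; apply/eqP/le_anti; rewrite sqr_ge0 andbT.
    rewrite -[leRHS](mul0r (p (w - w1) (w - w1))) -pv.
    by apply: form_CauchySchwarz => // t'; apply/p_ge0/orthD => //; exact: orthZ.
  by rewrite /p (formBr bB) (formBr qB) bvw1 qvw1 !subr0 => /eqP; rewrite subr_eq0 => /eqP.
exists ((Num.sqrt (q v v))^-1 *: v), m; split => //.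
- by rewrite (formZl qB) (formZr qB) mulrA -expr2 exprVn sqr_sqrtr ?mulVf// gt_eqF.
- exact: orthZ.
- by move=> w; rewrite (formZl bB) (formZl qB) vm mulrCA.
Qed.

Definition extend (k : nat) (T : Type) (e : nat -> T) (u : T) : nat -> T :=
  fun i => if i == k then u else e i.

Lemma orthonormal_extend k e u : form_orthonormal k e -> q u u = 1 ->
  orth k e u -> form_orthonormal k.+1 (extend k e u).
Proof.
move=> eo u1 uo i j; rewrite !ltnS /extend.
have [->|ik] := eqVneq i k; have [->|jk] := eqVneq j k => //=.
- by move=> _ h; rewrite uo ?ltn_neqAle ?jk// eq_sym (negbTE jk).
- by move=> h _; rewrite (formC qB) uo ?ltn_neqAle ?ik// (negbTE ik).
- by move=> h1 h2; rewrite eo ?ltn_neqAle ?ik ?jk.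
Qed.

(** The last clause makes the family extremal whatever [t] it started from: a subspace of dimension
    i + 1 meets the complement of the first i eigenvectors, so the next minimum is at most any [t']
    admissible for that subspace. This is what later identifies the largest [ms i] with [mu_j]. *)
Theorem subspace_le_eigen k (t : R) : t < 0 -> subspace_le t k ->
  exists e ms, [/\ form_orthonormal k e,
    forall i, (i < k)%N -> form_eigen (ms i) (e i) &
    forall t', subspace_le t' k -> forall i, (i < k)%N -> ms i <= t'].
Proof.
move=> t0; elim: k => [|k IH] tk.
  by exists (fun=> 0), (fun=> 0); split.
have [e [ms [eo ee em]]] := IH (subspace_leS tk).
have [u [m [u1 uo um mP]]] := minimizer eo ee (subspace_le_orth e tk) t0.
exists (extend k e u), (extend k ms m); split.
- exact: orthonormal_extend.
- move=> i; rewrite ltnS /extend; case: eqVneq => [//|ik h].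
  by apply: ee; rewrite ltn_neqAle ik.
- move=> t' t'k i; rewrite ltnS /extend; case: eqVneq => [_ _|ik h].
    have [w [wo [wq wb]]] := subspace_le_orth e t'k.
    by have := le_trans (mP _ wo) wb; rewrite ler_pM2r.
  by apply: em => //; [exact: subspace_leS|rewrite ltn_neqAle ik].
Qed.

Lemma eigen_orthogonal m m' u v : form_eigen m u -> form_eigen m' v -> m != m' ->
  q u v = 0.
Proof.
move=> um vm mm; have := um v; rewrite (formC bB) vm (formC qB v) => /eqP.
by rewrite -subr_eq0 -mulrBl mulf_eq0 subr_eq0 eq_sym (negbTE mm) => /eqP.
Qed.

(* [(t - m i) q (f i) (f j) = s i * s j * q (f i) (f j)] with
   [s i = sqrt (t - m i)]: eigenvectors of distinct eigenvalues are orthogonal *)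
Lemma eigen_lincomb_le k f (ms : nat -> R) (t : R) c :
  (forall i, (i < k)%N -> form_eigen (ms i) (f i)) ->
  (forall i, (i < k)%N -> ms i <= t) ->
  b (lincomb k c f) (lincomb k c f) <= t * q (lincomb k c f) (lincomb k c f).
Proof.
move=> fe mt; rewrite -subr_ge0.
pose s i := Num.sqrt (t - ms i).
have -> : t * q (lincomb k c f) (lincomb k c f) - b (lincomb k c f) (lincomb k c f) =
    q (lincomb k (fun i => c i * s i) f) (lincomb k (fun i => c i * s i) f); last exact: q_ge0.
rewrite /lincomb !(form_suml qB) (form_suml bB) mulr_sumr -sumrB.
apply: eq_bigr => i _; rewrite !(formZl qB) (formZl bB) fe// !(form_sumr qB).
rewrite (mulrCA t) -mulrBr -mulrBl -mulrA; congr (_ * _).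
rewrite !mulr_sumr; apply: eq_bigr => j _; rewrite !(formZr qB).
have [e|ne] := eqVneq (ms i) (ms j).
  have -> : s j = s i by rewrite /s e.
  have si : s i * s i = t - ms i by rewrite -expr2 sqr_sqrtr// subr_ge0 mt.
  by rewrite -si; ring.
by rewrite (eigen_orthogonal (fe i (ltn_ord i)) (fe j (ltn_ord j)) ne) !mulr0.
Qed.

Lemma orthonormal_indep k e : form_orthonormal k e -> form_indep k e.
Proof.
move=> eo c cq i ik.
have ci : q (lincomb k c e) (e i) = c i.
  rewrite /lincomb (form_suml qB) (bigD1 (Ordinal ik))//= (formZl qB) eo// eqxx mulr1.
  rewrite big1 ?addr0// => j; rewrite -val_eqE/= (formZl qB) eo// => /negbTE ->.
  by rewrite mulr0.
apply/eqP; rewrite -sqrf_eq0; apply/eqP/le_anti; rewrite sqr_ge0 andbT -ci.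
rewrite -(mul0r (q (e i) (e i))) -cq.
by apply: form_CauchySchwarz => // t; exact: q_ge0.
Qed.

Lemma eigen_subspace_le k e (ms : nat -> R) (t : R) : form_orthonormal k e ->
  (forall i, (i < k)%N -> form_eigen (ms i) (e i)) ->
  (forall i, (i < k)%N -> ms i <= t) -> subspace_le t k.
Proof.
move=> eo ee mt; exists e; split; first exact: orthonormal_indep.
by move=> c; exact: eigen_lincomb_le ee mt.
Qed.

(** Otherwise there would be an infinite orthonormal sequence of eigenvectors with eigenvalues at
    most [m], and b(e_i - e_j) = m_i + m_j <= 2m < m contradicts compactness with [eps = - m]. *)
Theorem subspace_le_finite (m : R) : m < 0 -> ~ forall k, subspace_le m k.
Proof.
move=> m0 mk.
pose good k (e : nat -> H) := form_orthonormal k e /\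
  forall i, (i < k)%N -> exists2 m', m' <= m & form_eigen m' (e i).
have /choice[F FP] : forall ke : nat * (nat -> H), exists u,
    good ke.1 ke.2 -> good ke.1.+1 (extend ke.1 ke.2 u).
  move=> [k e] /=; have [[eo ee]|ng] := pselect (good k e); last by exists 0.
  have [u [m' [u1 uo um mP]]] : exists u m', [/\ q u u = 1, orth k e u,
      form_eigen m' u & forall w, orth k e w -> m' * q w w <= b w w].
    pose ms i := if pselect (i < k)%N is left h then projT1 (cid2 (ee i h)) else 0.
    apply: (@minimizer k e ms m) => // [i ik|]; last exact: subspace_le_orth.
    by rewrite /ms; case: pselect => // h; case: cid2.
  exists u => _; split; first exact: orthonormal_extend.
  move=> i; rewrite ltnS /extend; case: eqVneq => [_ _|ik h].
    exists m' => //; have [w [wo [wq wb]]] := subspace_le_orth e (mk k.+1).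
    by have := le_trans (mP _ wo) wb; rewrite ler_pM2r.
  by apply: ee; rewrite ltn_neqAle ik.
pose E := fix E k : nat -> H := if k is k'.+1 then extend k' (E k') (F (k', E k')) else fun=> 0.
have Eg k : good k (E k) by elim: k => [|k IH]; [split|exact: (FP (k, E k) IH)].
(* The finite families [E k] are nested, so this diagonal is one infinite sequence extending all of
   them. *)
pose e i := E i.+1 i.
have Ee k i : (i < k)%N -> E k i = e i.
  elim: k => // k IH; rewrite ltnS leq_eqVlt => /orP[/eqP <-//|ik].
  by rewrite /= /extend ltn_eqF// IH.
have eo i j : q (e i) (e j) = (i == j)%:R.
  have [eo _] := Eg (maxn i j).+1.
  have il : (i < (maxn i j).+1)%N by rewrite ltnS leq_maxl.
  have jl : (j < (maxn i j).+1)%N by rewrite ltnS leq_maxr.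
  by rewrite -(Ee _ _ il) -(Ee _ _ jl) eo.
have em i : exists2 m', m' <= m & form_eigen m' (e i).
  by have [_] := Eg i.+1; apply.
have [G [UG ooG]] := @ultraFilterLemma nat \oo _.
have [A [GA AP]] := b_compact (u := e) (fun n => ltac:(by rewrite eo eqxx)) UG
   (eps := - m) ltac:(by rewrite oppr_gt0).
have [i Ai] := filter_ex GA.
have [j [Aj ij]] : exists j, A j /\ (i < j)%N.
  exact: filter_ex (filterI GA (ooG _ (nbhs_infty_gt i))).
have := AP _ _ Ai Aj; apply/negP; rewrite -ltNge opprK.
have [mi mim ei] := em i; have [mj mjm ej] := em j.
rewrite !(formBl bB, formBr bB) ei ej ei ej !eo !eqxx (ltn_eqF ij) (gtn_eqF ij).
by rewrite !mulr1n !mulr0n !mulr1 !mulr0 ?sub0r; lra.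
Qed.

End spectral.

(** * Square-integrable functions *)

Section Rintegral_lebesgue.
Context {R : realType}.
Local Notation mu := (@lebesgue_measure R).
Implicit Types f g : R -> R.

Lemma ae_sub (P Q : R -> Prop) : (forall x, P x -> Q x) ->
  (\forall x \ae mu, P x) -> \forall x \ae mu, Q x.
Proof. by move=> PQ; apply: (@filterS _ _ (ae_filter_ringOfSetsType mu)). Qed.

Lemma ae_and (P Q : R -> Prop) : (\forall x \ae mu, P x) ->
  (\forall x \ae mu, Q x) -> \forall x \ae mu, P x /\ Q x.
Proof. by move=> ? ?; apply: (@filterI _ _ (ae_filter_ringOfSetsType mu)). Qed.

Lemma ae_forall_nat (P : nat -> R -> Prop) : (forall n, \forall x \ae mu, P n x) ->
  \forall x \ae mu, forall n, P n x.
Proof. by move=> h; apply: ae_foralln => n; exact: h. Qed.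

Definition Rintegrable f := mu.-integrable [set: R] (EFin \o f).

Lemma RintegrableD f g : Rintegrable f -> Rintegrable g ->
  Rintegrable (fun x => f x + g x).
Proof. by move=> If Ig; exact: (integrableD measurableT If Ig). Qed.

Lemma RintegrableZ c f : Rintegrable f -> Rintegrable (fun x => c * f x).
Proof. by move=> If; exact: (integrableZl measurableT c If). Qed.

Lemma RintegrableB f g : Rintegrable f -> Rintegrable g ->
  Rintegrable (fun x => f x - g x).
Proof. by move=> If Ig; exact: (integrableB measurableT If Ig). Qed.

Lemma eq_Rintegrable f g : f =1 g -> Rintegrable f -> Rintegrable g.
Proof. by move=> /funext ->. Qed.

Lemma Rintegrable_measurable f : Rintegrable f -> measurable_fun setT f.
Proof. by move=> /integrableP[/measurable_EFinP]. Qed.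

Lemma le_Rintegrable f g : measurable_fun setT f -> (forall x, `|f x| <= g x) ->
  Rintegrable g -> Rintegrable f.
Proof.
move=> mf fg; apply: le_integrable => //; first exact/measurable_EFinP.
by move=> x _ /=; rewrite lee_fin (le_trans (fg x))// ler_norm.
Qed.

Lemma Rintegral_le f g : Rintegrable f -> Rintegrable g -> (forall x, f x <= g x) ->
  \int[mu]_x f x <= \int[mu]_x g x.
Proof. by move=> If Ig fg; apply: le_Rintegral. Qed.

Lemma Rintegral_ae f g : measurable_fun setT f -> measurable_fun setT g ->
  (\forall x \ae mu, f x = g x) -> \int[mu]_x f x = \int[mu]_x g x.
Proof.
move=> mf mg fg; congr fine; apply: ae_eq_integral => //.
- exact/measurable_EFinP.
- exact/measurable_EFinP.
- by move: fg; apply: ae_sub => x /= ->.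
Qed.

Lemma EFin_Rintegral f : Rintegrable f ->
  (\int[mu]_x f x)%:E = (\int[mu]_x (f x)%:E)%E.
Proof. by move=> If; rewrite fineK//; exact: integrable_fin_num. Qed.

Lemma Rintegral_le_ae f g : Rintegrable f -> Rintegrable g ->
  (\forall x \ae mu, f x <= g x) -> \int[mu]_x f x <= \int[mu]_x g x.
Proof.
move=> If Ig fg.
have -> : \int[mu]_x f x = \int[mu]_x (Num.min (f x) (g x)).
  apply: Rintegral_ae; first exact: Rintegrable_measurable.
    by apply: measurable_minr; exact: Rintegrable_measurable.
  by move: fg; apply: ae_sub => x fg; rewrite min_l.
apply: Rintegral_le => //; last by move=> x; rewrite ge_min lexx orbT.
apply: (@le_Rintegrable _ (fun x => `|f x| + `|g x|)).
- by apply: measurable_minr; exact: Rintegrable_measurable.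
- by move=> x; rewrite /Num.min; case: ifP; rewrite ?lerDl ?lerDr.
- by apply: RintegrableD; exact: integrable_norm.
Qed.

Lemma Rintegral_eq0 f : Rintegrable f -> (forall x, 0 <= f x) ->
  \int[mu]_x f x = 0 -> \forall x \ae mu, f x = 0.
Proof.
move=> If f0 I0; have mf := measurable_int mu If.
have /(ae_eq_integral_abs mu measurableT mf) : (\int[mu]_x `|(EFin \o f) x| = 0)%E.
  under eq_integral do rewrite /= ger0_norm//.
  by rewrite -EFin_Rintegral// I0.
by apply: ae_sub => x /= /(_ I)[].
Qed.

Lemma Rintegral_fatou (f : nat -> R -> R) g (c : R) :
  (forall n, Rintegrable (f n)) -> (forall n x, 0 <= f n x) ->
  (forall x, f ^~ x @ \oo --> g x) -> (forall n, \int[mu]_x f n x <= c) ->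
  Rintegrable g /\ \int[mu]_x g x <= c.
Proof.
move=> If f0 fg fc.
have mg : measurable_fun setT g.
  by apply: (@measurable_fun_cvg _ _ _ _ f) => // n; exact: Rintegrable_measurable.
have g0 x : 0 <= g x.
  by rewrite -(cvg_lim _ (fg x))//; apply: limr_ge; [apply: cvgP (fg x)|exact: nearW].
have gc : (\int[mu]_x (g x)%:E <= c%:E)%E.
  have := @fatou _ _ _ mu setT measurableT (fun n => EFin \o f n)
    (fun n => measurable_int mu (If n)) (fun n x _ => f0 n x).
  have lE x : limn_einf (fun n => (EFin \o f n) x) = (g x)%:E.
    apply: (cvg_limn_einf_sup _).1.
    by apply: cvg_EFin; [exact: nearW|exact: fg].
  under eq_integral do rewrite lE.
  move=> /le_trans; apply.
  rewrite limn_einf_lim; apply: lime_le.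
    exact: is_cvg_einfs.
  apply: nearW => n; apply: ge_ereal_inf.
  exists (\int[mu]_x (f n x)%:E)%E; first by exists n => //=.
  by rewrite -EFin_Rintegral// lee_fin.
have Ig : Rintegrable g.
  apply/integrableP; split; first exact/measurable_EFinP.
  under eq_integral do rewrite /= ger0_norm//.
  exact: le_lt_trans gc (ltry _).
by split=> //; rewrite -lee_fin EFin_Rintegral.
Qed.
End Rintegral_lebesgue.

(** * The inner product space L^2 and its completeness *)

Section L2_theory.
Context {R : realType}.
Local Notation mu := (@lebesgue_measure R).
Implicit Types f g : R -> R.

Lemma L2P f : L2 f <-> measurable_fun setT f /\ Rintegrable (fun x => f x ^+ 2).
Proof.
have sq : (\int[mu]_x `|(EFin \o (fun x => f x ^+ 2)%R) x| = \int[mu]_x (f x ^+ 2)%R%:E)%E.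
  by apply: eq_integral => x _ /=; rewrite ger0_norm ?sqr_ge0.
split=> [[mf If]|[mf /integrableP[_]]].
  split=> //; apply/integrableP; rewrite sq; split => //.
  by apply/measurable_EFinP; exact: measurable_funX.
by rewrite sq.
Qed.

Lemma L2_measurable f : L2 f -> measurable_fun setT f.
Proof. by case. Qed.

Lemma L2_integrable_sqr f : L2 f -> Rintegrable (fun x => f x ^+ 2).
Proof. by move=> /L2P[]. Qed.

Lemma L2_integrable_mul f g : L2 f -> L2 g -> Rintegrable (fun x => f x * g x).
Proof.
move=> Lf Lg; apply: (le_Rintegrable (g := fun x => f x ^+ 2 + g x ^+ 2)).
- by apply: measurable_funM; exact: L2_measurable.
- move=> x; have := sqr_ge0 (`|f x| - `|g x|); have := sqr_ge0 (`|f x| + `|g x|).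
  have := real_normK (num_real (f x)); have := real_normK (num_real (g x)).
  rewrite normrM; nra.
- by apply: RintegrableD; exact: L2_integrable_sqr.
Qed.

Lemma L2D f g : L2 f -> L2 g -> L2 (f + g).
Proof.
move=> Lf Lg; apply/L2P; split.
  by apply: measurable_funD; exact: L2_measurable.
apply: (@eq_Rintegrable _ (fun x => f x ^+ 2 + 2 * (f x * g x) + g x ^+ 2)).
  by move=> x; rewrite !fctE; ring.
apply: RintegrableD; last exact: L2_integrable_sqr.
apply: RintegrableD; first exact: L2_integrable_sqr.
by apply: RintegrableZ; exact: L2_integrable_mul.
Qed.

Lemma L2Z c f : L2 f -> L2 (c *: f).
Proof.
move=> Lf; apply/L2P; split.
  by apply: measurable_funM => //; case: Lf.
apply: (@eq_Rintegrable _ (fun x => c ^+ 2 * f x ^+ 2)).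
  by move=> x; rewrite -exprMn.
by apply: RintegrableZ => //; exact: L2_integrable_sqr.
Qed.

Lemma L2_0 : L2 (0 : R -> R).
Proof.
apply/L2P; split; first exact: measurable_cst.
apply: (@eq_Rintegrable _ (fun=> 0)); last exact: integrable0.
by move=> x; rewrite expr0n.
Qed.

Definition L2_pred : {pred (R -> R)} := fun f => `[< L2 f >].

Lemma L2_submod : submod_closed L2_pred.
Proof.
split; first by apply/asboolP; exact: L2_0.
by move=> c f g /asboolP Lf /asboolP Lg; apply/asboolP/L2D => //; exact: L2Z.
Qed.

HB.instance Definition _ := GRing.isSubmodClosed.Build R (R -> R) L2_pred L2_submod.

Definition L2t := {f : R -> R | f \in L2_pred}.
HB.instance Definition _ := SubType.on L2t.
HB.instance Definition _ := Choice.on L2t.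
HB.instance Definition _ := [SubChoice_isSubLmodule of L2t by <:].

Definition L2_fun (f : L2t) : R -> R := val f.
Coercion L2_fun : L2t >-> Funclass.

Definition L2_ip (f g : L2t) : R := \int[mu]_x (f x * g x).

Lemma L2tP (f : L2t) : L2 f.
Proof. by apply/asboolP; exact: (valP f). Qed.

Lemma L2_ip_sym_bilinear : sym_bilinear L2_ip.
Proof.
split=> [f g|f g h|c f g]; rewrite /L2_ip.
- by apply: eq_Rintegral => x _; rewrite mulrC.
- rewrite -RintegralD//; [|exact: L2_integrable_mul (L2tP _) (L2tP _)..].
  by apply: eq_Rintegral => x _; rewrite -mulrDl.
- rewrite -RintegralZl//; [|exact: L2_integrable_mul (L2tP _) (L2tP _)].
  by apply: eq_Rintegral => x _; rewrite mulrA.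
Qed.

Lemma L2_ip_ge0 (f : L2t) : 0 <= L2_ip f f.
Proof. by apply: Rintegral_ge0 => x _; rewrite -expr2 sqr_ge0. Qed.

Lemma L2_ipE (f : L2t) : L2_ip f f = \int[mu]_x (f x ^+ 2).
Proof. by apply: eq_Rintegral => x _; rewrite expr2. Qed.

Lemma L2_funD (f g : L2t) x : L2_fun (f + g) x = f x + g x.
Proof. by []. Qed.

Lemma L2_funB (f g : L2t) x : L2_fun (f - g) x = f x - g x.
Proof. by []. Qed.

Lemma L2_funZ c (f : L2t) x : L2_fun (c *: f) x = c * f x.
Proof. by []. Qed.

Lemma L2_fun_add (f g : L2t) : L2_fun (f + g) = L2_fun f + L2_fun g.
Proof. by []. Qed.

Lemma L2_fun_scale c (f : L2t) : L2_fun (c *: f) = c *: L2_fun f.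
Proof. by []. Qed.

Definition toL2 f (Lf : L2 f) : L2t := exist _ f (introT (asboolP _) Lf).

Lemma toL2E f (Lf : L2 f) : toL2 Lf = f :> (R -> R).
Proof. by []. Qed.

Section completeness.
Variable f : nat -> L2t.
Hypothesis fcauchy : forall n, L2_ip (f n.+1 - f n) (f n.+1 - f n) <= 8^-1 ^+ n.

Let d n x := f n.+1 x - f n x.

Let d_int n : \int[mu]_x (d n x ^+ 2) <= 8^-1 ^+ n.
Proof. by have := fcauchy n; rewrite L2_ipE. Qed.

(** The rate 8^-n leaves room for the weight 2^n: the integral of [w n] is at most 4^-n and stays
    summable. *)
Let w n x := 2 ^+ n * d n x ^+ 2.

Let w0 n x : (0 <= (w n x)%:E)%E.
Proof. by rewrite lee_fin /w mulr_ge0 ?sqr_ge0 ?exprn_ge0. Qed.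

Let w_int n : Rintegrable (w n).
Proof. exact/RintegrableZ/(L2_integrable_sqr (L2tP (f n.+1 - f n))). Qed.

Let wsum_lty : (\int[mu]_x (\sum_(0 <= n <oo) (w n x)%:E) < +oo)%E.
Proof.
rewrite integral_nneseries//; last by move=> n; exact: (measurable_int mu (w_int n)).
apply: (@le_lt_trans _ _ 2%:E); last exact: ltry.
apply: lime_le.
  by apply: is_cvg_nneseries => n _ _; exact: integral_ge0.
apply: nearW => k.
rewrite (_ : (\sum_(0 <= i < k) _)%E = (\sum_(0 <= i < k) \int[mu]_x (w i x))%:E); last first.
  by rewrite -sumEFin; apply: eq_bigr => i _; rewrite EFin_Rintegral.
(* The subtracted term carries the induction: 4^-k <= 2 (4^-k - 4^-(k+1)). *)
rewrite lee_fin; apply: (@le_trans _ _ (2 - 2 * 4^-1 ^+ k)); last first.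
  by rewrite lerBlDr lerDl mulr_ge0 ?exprn_ge0.
elim: k => [|k IH]; first by rewrite big_nil expr0 mulr1 subrr.
rewrite big_nat_recr//=.
have : \int[mu]_x w k x <= 4^-1 ^+ k.
  rewrite /w RintegralZl//; last exact: (L2_integrable_sqr (L2tP (f k.+1 - f k))).
  apply: (@le_trans _ _ (2 ^+ k * 8^-1 ^+ k)); first by rewrite ler_pM2l ?exprn_gt0.
  by rewrite -exprMn (_ : 2 * 8^-1 = 4^-1 :> R)//; field.
have : 0 <= (4^-1 : R) ^+ k by rewrite exprn_ge0.
by rewrite exprS; move: IH; lra.
Qed.

(* AM-GM: [`|d n x| <= 2^-n + 2^n * d n x ^+ 2], and the right-hand side is
   summable for almost every [x] *)
Let f_ae_cvg : \forall x \ae mu, cvgn (fun n => f n x).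
Proof.
have : mu.-integrable setT (fun x => \sum_(0 <= n <oo) (w n x)%:E)%E.
  apply/integrableP; split.
    by apply: ge0_emeasurable_sum => // k _; exact: (measurable_int mu (w_int k)).
  apply: le_lt_trans wsum_lty; rewrite le_eqVlt; apply/orP; left; apply/eqP.
  by apply: eq_integral => x _; rewrite gee0_abs// nneseries_ge0.
move=> /(integrable_ae measurableT).
apply: ae_sub => x /(_ I) h.
have cw : cvgn (series (fun n => w n x)).
  apply: nondecreasing_is_cvgn.
    by apply: nondecreasing_series => n _ _; have := w0 n x; rewrite lee_fin.
  exists (fine (\sum_(0 <= n <oo) (w n x)%:E)%E) => _ [n _ <-].
  rewrite -lee_fin fineK// /series/= -sumEFin.
  exact: nneseries_lim_ge.
have cd : cvgn (series (fun n => d n x)).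
  apply: normed_cvg.
  apply: (@series_le_cvg _ _ (geometric 1 2^-1 + (fun n => w n x))) => [n|n|n|].
  - exact: normr_ge0.
  - apply: addr_ge0; last by have := w0 n x; rewrite lee_fin.
    by rewrite /geometric/= mul1r exprn_ge0.
  - rewrite /= /geometric/= /w fctE mul1r exprVn.
    have h2 : 0 < (2 : R) ^+ n by rewrite exprn_gt0.
    have h3 : (2 ^+ n)^-1 * 2 ^+ n = 1 :> R by rewrite mulVf// gt_eqF.
    have h4 : 0 < ((2 : R) ^+ n)^-1 by rewrite invr_gt0.
    move: h2 h3 h4; set a := 2 ^+ n; set b := a^-1 => h2 h3 h4.
    have h5 : `|d n x| ^+ 2 = d n x ^+ 2 := real_normK (num_real _).
    have := sqr_ge0 (b - `|d n x|); rewrite sqrrB h5 => h6.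
    rewrite -(ler_pM2l h4) mulrDr (mulrA b a) h3 mul1r -expr2.
    have := normr_ge0 (d n x); rewrite mulr2n in h6; nra.
  - rewrite -[series _]/(series (geometric 1 2^-1 \+ (fun n => w n x))) seriesD.
    apply: is_cvgD => //; apply: is_cvg_geometric_series.
    by rewrite ger0_norm// invf_lt1// ltr1n.
apply/cvg_ex; exists (f 0%N x + limn (series (fun n => d n x))).
rewrite (_ : (fun n => f n x) = (fun n => f 0%N x + series (fun n => d n x) n)).
  by apply: cvgD => //; exact: cvg_cst.
by apply/funext => n; rewrite [LHS](eq_sum_telescope (fun n => f n x)).
Qed.

(** The constant 4 closes the induction: 2 * 4 * 8^-(n+1) + 2 * 8^-n = 3 * 8^-n. *)
Let fB n k : L2_ip (f (n + k)%N - f n) (f (n + k)%N - f n) <= 4 * 8^-1 ^+ n.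
Proof.
elim: k n => [|k IH] n.
  by rewrite addn0 subrr (form0l L2_ip_sym_bilinear) mulr_ge0 ?exprn_ge0.
rewrite addnS -addSn -(subrK (f n.+1) (f (n.+1 + k)%N)) -addrA.
have := L2_ip_ge0 ((f (n.+1 + k)%N - f n.+1) - (f n.+1 - f n)).
have := form_parallelogram L2_ip_sym_bilinear (f (n.+1 + k)%N - f n.+1) (f n.+1 - f n).
have := IH n.+1; have := fcauchy n; rewrite exprS.
have : 0 <= (8^-1 : R) ^+ n by rewrite exprn_ge0.
lra.
Qed.

Lemma L2_complete : exists g : L2t, forall eps : R, 0 < eps -> exists N, forall n,
  (N <= n)%N -> L2_ip (f n - g) (f n - g) <= eps.
Proof.
have [N [mN N0 fN]] := f_ae_cvg.
pose E := ~` N.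
have mE : measurable E by exact: measurableC.
(* Cutting off the exceptional null set makes the sequence converge at every point, so that [g] is
   measurable and Fatou applies to F n - F (n + k) as k grows. *)
pose F n x := f n x * \1_E x.
have mF n : measurable_fun setT (F n).
  by apply: measurable_funM; [exact: L2_measurable (L2tP _)|exact: measurable_indic].
have aeF n : \forall x \ae mu, f n x = F n x.
  exists N; split => // x /= h; apply: contrapT => Nx; apply: h.
  by rewrite /F indicE mem_set// mulr1.
pose g x := limn (fun n => F n x).
have Fg x : F ^~ x @ \oo --> g x.
  rewrite /g /F indicE; case: (boolP (x \in E)) => [|_].
    rewrite inE => Ex /=; under eq_fun do rewrite mulr1.
    by apply: contrapT => h; apply: Ex; apply: fN.
  under eq_fun do rewrite mulr0; rewrite lim_cst//; exact: cvg_cst.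
have mg : measurable_fun setT g by exact: (@measurable_fun_cvg _ _ _ _ F).
have iE x (y : R) : `|(y * \1_E x) ^+ 2| <= y ^+ 2.
  rewrite indicE; case: (x \in E); rewrite ?mulr1 ?mulr0.
    by rewrite ger0_norm ?sqr_ge0.
  by rewrite expr0n/= normr0 sqr_ge0.
have IF n k : Rintegrable (fun x => (F n x - F k x) ^+ 2).
  apply: (le_Rintegrable _ _ (L2_integrable_sqr (L2tP (f n - f k)))).
    by apply: measurable_funX; exact: measurable_funB.
  by move=> x; rewrite /F -mulrBl.
have Fgle n : Rintegrable (fun x => (F n x - g x) ^+ 2) /\
    \int[mu]_x ((F n x - g x) ^+ 2) <= 4 * 8^-1 ^+ n.
  apply: (@Rintegral_fatou _ (fun k x => (F n x - F (n + k)%N x) ^+ 2)) => [k|k x|x|k].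
  - exact: IF.
  - exact: sqr_ge0.
  - apply: (@cvg_comp _ _ _ _ (fun y : R => y ^+ 2)); last exact: exprn_continuous.
    apply: cvgB; first exact: cvg_cst.
    have -> : (fun k => F (n + k)%N x) = (fun k => F (k + n)%N x).
      by apply/funext => k; rewrite addnC.
    by rewrite (cvg_shiftn n (F ^~ x)).
  - apply: le_trans (fB n k); rewrite L2_ipE le_eqVlt; apply/orP; left; apply/eqP.
    apply: Rintegral_ae.
    + by apply: measurable_funX; exact: measurable_funB.
    + by apply: measurable_funX; exact: L2_measurable (L2tP _).
    + by apply: ae_sub (ae_and (aeF n) (aeF (n + k)%N)) => x [<- <-]; rewrite L2_funB -sqrrN opprB.
have LF0 : L2 (F 0%N).
  apply/L2P; split => //; apply: (le_Rintegrable _ _ (L2_integrable_sqr (L2tP (f 0%N)))).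
    exact: measurable_funX.
  by move=> x; rewrite /F.
have Lg : L2 g.
  have -> : g = F 0%N + (-1) *: (fun x => F 0%N x - g x).
    by apply/funext => x; rewrite !fctE scaleN1r opprB addrC subrK.
  apply: L2D => //; apply: L2Z; apply/L2P; split; first exact: measurable_funB.
  exact: (Fgle 0%N).1.
exists (toL2 Lg) => eps eps0.
exists (Num.truncn (4 / eps)).+1 => n Nn.
have -> : L2_ip (f n - toL2 Lg) (f n - toL2 Lg) = \int[mu]_x ((F n x - g x) ^+ 2).
  rewrite L2_ipE; apply: Rintegral_ae.
  - by apply: measurable_funX; exact: L2_measurable (L2tP _).
  - by apply: measurable_funX; exact: measurable_funB.
  - by apply: ae_sub (aeF n) => x <-.
apply: le_trans (Fgle n).2 _.
rewrite exprVn ler_pdivrMr ?exprn_gt0// -ler_pdivrMl// mulrC.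
apply: ltW; apply: lt_le_trans (truncnS_gt _) _.
apply: (@le_trans _ _ n%:R); first by rewrite ler_nat.
by rewrite -natrX ler_nat ltnW// ltn_expl.
Qed.

End completeness.

End L2_theory.

(** * C^1 bump functions *)

Section bump.
Context {R : realType}.
Local Notation mu := (@lebesgue_measure R).
Implicit Types a b c x y t : R.

(** A quadratic remainder settles differentiability also at the junction points of the piecewise
    quadratic [step], with no one-sided limits. *)
Lemma is_derive_quadratic (f : R -> R) x l C :
  (forall y, `|f y - f x - l * (y - x)| <= C * (y - x) ^+ 2) -> is_derive x 1 f l.
Proof.
move=> fC.
have C0 : 0 <= C.
  by have := le_trans (normr_ge0 _) (fC (x + 1)); rewrite addrC addKr expr1n mulr1.
have cf : (fun h => h^-1 *: ((f \o shift x) (h *: 1) - f x)) @ 0^' --> l.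
  apply/cvgrPdist_le => e e0; near=> h.
  have h0 : h != 0 by near: h; exact: nbhs_dnbhs_neq.
  rewrite /= [h%:A]mulr1 -[_ *: _]/(h^-1 * (f (h + x) - f x)).
  have -> : l - h^-1 * (f (h + x) - f x) = - (h^-1 * (f (h + x) - f x - l * (h + x - x))).
    by rewrite addrK; field.
  rewrite normrN normrM normfV.
  apply: (@le_trans _ _ (C * `|h|)).
    rewrite ler_pdivrMl ?normr_gt0//; apply: le_trans (fC _) _.
    by rewrite addrK -real_normK ?num_real// expr2; lra.
  have : `|h| <= e / (C + 1).
    near: h; apply: dnbhs0_le; rewrite divr_gt0// ltr_wpDl//.
  rewrite ler_pdivlMr ?ltr_wpDl// => h1.
  by apply: le_trans h1; rewrite mulrDr mulr1 mulrC lerDl.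
apply: DeriveDef; first by apply: cvgP cf.
exact: (cvg_lim _ cf).
Unshelve. all: by end_near. Qed.

Definition pospart t : R := Num.max 0 t.

(* [step] is the C^1 primitive of the tent function supported on [0, 2] *)
Definition step t : R :=
  (pospart t ^+ 2 - 2 * pospart (t - 1) ^+ 2 + pospart (t - 2) ^+ 2) / 2.
Definition tent t : R := pospart t - 2 * pospart (t - 1) + pospart (t - 2).

Lemma pospart_cases t :
  (t <= 0 /\ pospart t = 0) \/ (0 <= t /\ pospart t = t).
Proof. by rewrite /pospart; case: (leP 0 t) => h; [right|left; split=> //; exact: ltW]. Qed.

Ltac split_pospart := rewrite /step /tent;
  repeat match goal with |- context [pospart ?t] =>
    case: (pospart_cases t) => -[? ->] end.

Lemma tent_ge0 t : 0 <= tent t. Proof. by split_pospart; lra. Qed.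
Lemma tent_le1 t : tent t <= 1. Proof. by split_pospart; lra. Qed.
Lemma tent_le0 t : t <= 0 -> tent t = 0. Proof. by move=> ?; split_pospart; lra. Qed.
Lemma tent_ge2 t : 2 <= t -> tent t = 0. Proof. by move=> ?; split_pospart; lra. Qed.
Lemma step_le0 t : t <= 0 -> step t = 0. Proof. by move=> ?; split_pospart; nra. Qed.
Lemma step_ge2 t : 2 <= t -> step t = 1. Proof. by move=> ?; split_pospart; nra. Qed.
Lemma step_ge0 t : 0 <= step t. Proof. by split_pospart; nra. Qed.
Lemma step_le1 t : step t <= 1. Proof. by split_pospart; nra. Qed.

Lemma pospart_quadratic t s :
  `|pospart t ^+ 2 - pospart s ^+ 2 - 2 * pospart s * (t - s)| <= (t - s) ^+ 2.
Proof.
have h := sqr_ge0 (t - s); rewrite ler_norml.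
case: (pospart_cases t) => -[ht ->]; case: (pospart_cases s) => -[hs ->].
- by apply/andP; split; lra.
- have h1 : 0 <= - t * s by rewrite mulr_ge0// oppr_ge0.
  have h2 := sqr_ge0 t; have h3 := sqr_ge0 s.
  by apply/andP; split; lra.
- have h1 : 0 <= t * - s by rewrite mulr_ge0// oppr_ge0.
  have h2 := sqr_ge0 t; have h3 := sqr_ge0 s.
  by apply/andP; split; lra.
- by apply/andP; split; lra.
Qed.

(** The constant is (1 + 2 + 1) / 2, from the three squares in [step]. *)
Lemma step_quadratic t s :
  `|step t - step s - tent s * (t - s)| <= 2 * (t - s) ^+ 2.
Proof.
have := pospart_quadratic t s.
have := pospart_quadratic (t - 1) (s - 1); have := pospart_quadratic (t - 2) (s - 2).
rewrite (_ : t - 1 - (s - 1) = t - s); last by ring.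
rewrite (_ : t - 2 - (s - 2) = t - s); last by ring.
rewrite !ler_norml /step /tent => /andP[h1 h2] /andP[h3 h4] /andP[h5 h6].
by apply/andP; split; lra.
Qed.

Lemma pospart_continuous : continuous pospart.
Proof. by apply: max_fun_continuous => x; [exact: cvg_cst|exact: cvg_id]. Qed.

Lemma tent_continuous : continuous tent.
Proof.
have pc d : continuous (fun t => pospart (t - d)).
  move=> t; apply: (@continuous_comp _ _ _ (fun t => t - d) pospart).
    by apply: cvgB; [exact: cvg_id|exact: cvg_cst].
  exact: pospart_continuous.
move=> t; apply: cvgD; last exact: pc.
apply: cvgB; first exact: pospart_continuous.
by apply: cvgM; [exact: cvg_cst|exact: pc].
Qed.

Definition stepn (n : R) a x := step (n * (x - a)).
Definition kern (n : R) a x := n * tent (n * (x - a)).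

Lemma stepn_quadratic (n : R) a x y :
  `|stepn n a y - stepn n a x - kern n a x * (y - x)| <= 2 * n ^+ 2 * (y - x) ^+ 2.
Proof.
have := step_quadratic (n * (y - a)) (n * (x - a)).
rewrite (_ : n * (y - a) - n * (x - a) = n * (y - x)); last by ring.
rewrite (_ : tent _ * _ = kern n a x * (y - x)); last by rewrite /kern; ring.
by rewrite exprMn mulrA.
Qed.

Lemma is_derive_stepn n a x : is_derive x 1 (stepn n a) (kern n a x).
Proof. exact: is_derive_quadratic (stepn_quadratic n a x). Qed.

Lemma kern_continuous n a : continuous (kern n a).
Proof.
move=> x; apply: cvgM; first exact: cvg_cst.
apply: (@continuous_comp _ _ _ (fun x => n * (x - a)) tent); last exact: tent_continuous.
apply: cvgM; first exact: cvg_cst.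
by apply: cvgB; [exact: cvg_id|exact: cvg_cst].
Qed.

Lemma kern_ge0 n a x : 0 < n -> 0 <= kern n a x.
Proof. by move=> n0; rewrite mulr_ge0 ?tent_ge0// ltW. Qed.

Lemma kern_le n a x : 0 < n -> kern n a x <= n.
Proof. by move=> n0; rewrite ler_piMr ?tent_le1// ltW. Qed.

Lemma kern_out n a x : 0 < n -> ~~ (a < x < a + 2 / n) -> kern n a x = 0.
Proof.
move=> n0; rewrite negb_and -!leNgt /kern => /orP[xa|ax].
  by rewrite tent_le0 ?mulr0// pmulr_rle0// subr_le0.
by rewrite tent_ge2 ?mulr0// mulrC -ler_pdivrMr// lerBrDl.
Qed.

Lemma stepn_left n a x : 0 < n -> x <= a -> stepn n a x = 0.
Proof. by move=> n0 xa; rewrite /stepn step_le0// pmulr_rle0// subr_le0. Qed.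

Lemma stepn_right n a x : 0 < n -> a + 2 / n <= x -> stepn n a x = 1.
Proof.
by move=> n0 ax; rewrite /stepn step_ge2// mulrC -ler_pdivrMr// lerBrDl.
Qed.

(** For a < b, a C^1 plateau tending to the indicator of ]a, b]. Its derivative is a difference of
    two approximate identities, concentrating at [a] and at [b]. *)
Definition bump n a b x := stepn n a x - stepn n b x.

Lemma is_derive_bump n a b x : is_derive x 1 (bump n a b) (kern n a x - kern n b x).
Proof. exact: is_deriveB (is_derive_stepn n a x) (is_derive_stepn n b x). Qed.

Lemma derive1_bump n a b : derive1 (bump n a b) = (fun x => kern n a x - kern n b x).
Proof.
by apply/funext => x; rewrite derive1E; have [_ ->] := is_derive_bump n a b x.
Qed.

Lemma test_fun_bump n a b : 0 < n -> test_fun (bump n a b).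
Proof.
move=> n0; split; [by move=> x; have [] := is_derive_bump n a b x|split].
  rewrite derive1_bump => x.
  by apply: cvgB; exact: kern_continuous.
exists (`|a| + `|b| + 2 / n) => x xM; rewrite /bump.
have n20 : 0 < 2 / n by rewrite divr_gt0.
have [x0|x0] := lerP 0 x.
  rewrite !stepn_right// ?subrr//.
    apply: ltW; apply: le_lt_trans _ (lt_le_trans xM _); last by rewrite ger0_norm.
    by rewrite lerD2r (le_trans (ler_norm b))// lerDr.
  apply: ltW; apply: le_lt_trans _ (lt_le_trans xM _); last by rewrite ger0_norm.
  by rewrite lerD2r (le_trans (ler_norm a))// lerDl.
have := ler_norm (- a); have := ler_norm (- b); rewrite !normrN.
rewrite (ltr0_norm x0) in xM.
have := normr_ge0 a; have := normr_ge0 b => h1 h2 h3 h4.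
by rewrite !stepn_left ?subrr//; lra.
Qed.

Lemma Rintegral_kern n a : 0 < n -> \int[mu]_x kern n a x = 1.
Proof.
move=> n0; have n20 : 0 < 2 / n by rewrite divr_gt0.
have -> : \int[mu]_x kern n a x = \int[mu]_(x in `[a, a + 2 / n]) kern n a x.
  rewrite [RHS]Rintegral_mkcond; apply: eq_Rintegral => x _.
  rewrite patchE; case: ifPn => // xI; rewrite kern_out//.
  apply: contra xI => /andP[ax xa]; rewrite inE/= in_itv/= !ltW//.
rewrite /Rintegral (@continuous_FTC2 _ _ (stepn n a)).
- by rewrite -EFinB/= stepn_right// stepn_left// subr0.
- by rewrite ltrDl.
- by apply: continuous_subspaceT => x; exact: kern_continuous.
- have sc : continuous (stepn n a).
    move=> x; apply: differentiable_continuous; apply/derivable1_diffP.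
    by have [] := is_derive_stepn n a x.
  split; [by move=> x _; have [] := is_derive_stepn n a x| |].
    exact/cvg_at_right_filter/sc.
  exact/cvg_at_left_filter/sc.
- by move=> x _; rewrite derive1E; have [_ ->] := is_derive_stepn n a x.
Qed.

End bump.

(** * Weak derivatives at Lebesgue points *)

Section weak_derivative.
Context {R : realType}.
Local Notation mu := (@lebesgue_measure R).
Implicit Types (u g f : R -> R) (a b x : R).

Lemma Rintegral_dominated_cvg (f : nat -> R -> R) (g h : R -> R) :
  (forall n, measurable_fun setT (f n)) -> (forall x, f ^~ x @ \oo --> g x) ->
  (forall n x, `|f n x| <= h x) -> Rintegrable h ->
  (fun n => \int[mu]_x f n x) @ \oo --> \int[mu]_x g x.
Proof.
move=> mf fg fh Ih.
have mg : measurable_fun setT g by exact: (@measurable_fun_cvg _ _ _ _ f).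
have cae : \forall x \ae mu, setT x -> (EFin \o f n) x @[n --> \oo] --> (EFin \o g) x.
  by apply: aeW => x _; apply: cvg_EFin; [exact: nearW|exact: fg].
have bae : \forall x \ae mu, forall n, setT x -> (`|(EFin \o f n) x| <= (EFin \o h) x)%E.
  by apply: aeW => x n _; rewrite /= lee_fin.
have mEf n : measurable_fun setT (EFin \o f n) by exact/measurable_EFinP.
have [| | | | |Ig _ cv] := @dominated_convergence _ _ _ mu setT measurableT
  (fun n => EFin \o f n) (EFin \o g) (EFin \o h) => //.
  exact/measurable_EFinP.
have If n : Rintegrable (f n) by exact: le_Rintegrable Ih.
apply: fine_cvg; rewrite -/(Rintegral mu setT g) EFin_Rintegral//.
Qed.

Lemma L2_bounded_support f (C : R) a b : measurable_fun setT f ->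
  (forall x, `|f x| <= C) -> (forall x, x \notin `[a, b] -> f x = 0) -> L2 f.
Proof.
move=> mf fC f0; apply/L2P; split => //.
apply: (@le_Rintegrable _ _ (fun x => C ^+ 2 * \1_`[a, b] x)).
- exact: measurable_funX.
- move=> x; rewrite normrX indicE; case: (boolP (x \in _)) => h.
    by rewrite mulr1 lerXn2r ?nnegrE// (le_trans _ (fC x)).
  rewrite f0 ?normr0 ?expr0n ?mulr0//.
  by apply: contra h => h; rewrite inE.
- by apply: RintegrableZ; exact: (integrable_indic_itv a b true false).
Qed.

Lemma L2_indic_itv (b1 b2 : bool) a b : L2 (\1_[set` Interval (BSide b1 a) (BSide b2 b)] : R -> R).
Proof.
apply: (@L2_bounded_support _ 1 a b) => [|x|x].
- exact: measurable_indic.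
- by rewrite indicE; case: (_ \in _); rewrite ?normr1 ?normr0.
- rewrite indicE => h; rewrite memNset//= => h'; move/negP: h; apply.
  move: h'; rewrite !itv_boundlr /= => /andP[].
  by case: b1; case: b2; rewrite !bnd_simp => h1 h2; apply/andP; split=> //; exact: ltW.
Qed.

Lemma L2_continuous_support f a b : continuous f ->
  (forall x, x \notin `[a, b] -> f x = 0) -> L2 f.
Proof.
move=> cf f0; have [ab|ba] := leP a b; last first.
  apply: (@L2_bounded_support f 0 a b) => // [|x]; first exact: continuous_measurable_fun.
  rewrite f0 ?normr0// in_itv/=; apply/negP => /andP[h1 h2].
  by have := le_lt_trans (le_trans h1 h2) ba; rewrite ltxx.
have cn : {within `[a, b], continuous (fun x => `|f x|)}.
  by apply: continuous_subspaceT => x; apply: cvg_norm; exact: cf.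
have [c _ cm] := EVT_max ab cn.
apply: (@L2_bounded_support f `|f c| a b) => // [|x]; first exact: continuous_measurable_fun.
by case: (boolP (x \in `[a, b])) => [/cm//|/f0 ->]; rewrite normr0.
Qed.

Lemma test_fun_L2 (phi : R -> R) : test_fun phi -> L2 phi /\ L2 (derive1 phi).
Proof.
move=> [dphi [cphi [M phi0]]].
have out x : x \notin `[- M, M] -> M < `|x|.
  rewrite in_itv/= negb_and -!ltNge lter_normr => /orP[xM|->]; rewrite ?orbT//.
  by rewrite ltrNr xM orbT.
split.
  apply: (@L2_continuous_support _ (- M) M) => [x|x /out]; last exact: phi0.
  by apply: differentiable_continuous; exact/derivable1_diffP.
apply: (@L2_continuous_support _ (- M) M) => // x /out xM.
rewrite derive1E (@near_eq_derive _ _ _ _ (cst 0)) ?derive_cst//.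
have cn : (fun y : R => `|y|) @ x --> `|x| by exact: norm_continuous.
by near=> y; apply: phi0; near: y; exact: (cvgr_gt _ cn).
Unshelve. all: by end_near. Qed.

Lemma L2_kern n a : 0 < n -> L2 (kern n a).
Proof.
move=> n0; apply: (@L2_continuous_support _ a (a + 2 / n)); first exact: kern_continuous.
move=> x h; apply: kern_out => //; apply: contra h => /andP[h1 h2].
by rewrite in_itv/= !ltW.
Qed.

Lemma kern_cvg u a : L2 u -> lebesgue_pt u a ->
  (fun n => \int[mu]_x (u x * kern n.+1%:R a x)) @ \oo --> u a.
Proof.
move=> Lu ua; apply/cvgrPdist_le => e e0.
(* The kernel is at most N and supported in [a, a + 2/N], inside the ball of radius 3/N. That ball
   has length 6/N, hence a factor 6 in front of the mean deviation. *)
have : \forall r \near (0:R)^'+, (davg u a r < (e / 6)%:E)%E.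
  have /fine_cvgP[ufin /cvgrPdist_lt/(_ (e / 6))] := ua.
  move=> /(_ ltac:(by rewrite divr_gt0)) ulim.
  near=> r; have rfin : davg u a r \is a fin_num by near: r; exact: ufin.
  rewrite -(fineK rfin) lte_fin.
  have : `|0 - fine (davg u a r)| < e / 6 by near: r; exact: ulim.
  by rewrite sub0r normrN => /(le_lt_trans (ler_norm _)).
move=> hr.
have : \forall n \near \oo, (davg u a (3 / n.+1%:R) < (e / 6)%:E)%E.
  case: hr => d /= d0 hd.
  exists (Num.truncn (3 / d)).+1 => // n /= dn; apply: hd; last by rewrite divr_gt0.
  rewrite /ball_/= sub0r normrN ger0_norm ?divr_ge0// ltr_pdivrMr// -ltr_pdivrMl// mulrC.
  by apply: lt_le_trans (truncnS_gt _) _; rewrite ler_nat (leq_trans dn).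
apply: filterS => n hn.
set N : R := n.+1%:R in hn *.
have N0 : 0 < N by rewrite /N.
have r0 : 0 < 3 / N by rewrite divr_gt0.
have Iuk : Rintegrable (fun x => u x * kern N a x).
  by apply: L2_integrable_mul => //; exact: L2_kern.
have Ik : Rintegrable (kern N a).
  apply: (@eq_Rintegrable _ (fun x => \1_`[a, a + 2 / N] x * kern N a x)).
    move=> x; rewrite indicE; case: (boolP (x \in _)); rewrite ?mul1r// ?mul0r => xI.
    rewrite kern_out//; apply: contra xI => /andP[h1 h2].
    by rewrite inE/= in_itv/= !ltW.
  by apply: L2_integrable_mul; [exact: L2_indic_itv|exact: L2_kern].
have Id : Rintegrable (fun x => (u x - u a) * kern N a x).
  apply: (@eq_Rintegrable _ (fun x => u x * kern N a x - u a * kern N a x)).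
    by move=> x; rewrite mulrBl.
  by apply: RintegrableB => //; exact: RintegrableZ.
have -> : u a - \int[mu]_x (u x * kern N a x) = - \int[mu]_x ((u x - u a) * kern N a x).
  rewrite -[u a in LHS]mulr1 -(Rintegral_kern a N0) -RintegralZl// -opprB -RintegralB//.
    by congr (- _); apply: eq_Rintegral => x _; rewrite mulrBl.
  exact: RintegrableZ.
rewrite normrN -lee_fin EFin_normr_Rintegral//.
apply: le_trans (le_abse_integral mu measurableT (measurable_int mu Id)) _.
have mua : measurable_fun setT (fun x => (`|u x - u a|%:E)).
  apply/measurable_EFinP; apply: measurableT_comp => //.
  by apply: measurable_funB => //; exact: L2_measurable.
apply: (@le_trans _ _ (\int[mu]_(x in ball a (3 / N)) (N * `|u x - u a|)%:E)%E).
  rewrite [leRHS]integral_mkcond; apply: ge0_le_integral => //.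
  - by apply: measurableT_comp => //; exact: (measurable_int mu Id).
  - apply/(measurable_restrictT _ _).1; first exact: measurable_ball.
    apply: measurable_funTS; apply/measurable_EFinP; apply: measurable_funM => //.
    exact/measurable_EFinP.
  - move=> x _; rewrite patchE; case: ifPn => xb /=.
      by rewrite lee_fin normrM mulrC ler_wpM2r// ger0_norm ?kern_ge0// kern_le.
    rewrite lee_fin kern_out ?mulr0 ?normr0//; apply: contra xb => /andP[h1 h2].
    rewrite inE /ball/= distrC ger0_norm ?subr_ge0 ?ltW// ltrBlDl.
    apply: lt_trans h2 _; rewrite ltrD2l ltr_pM2r ?invr_gt0//; lra.
under eq_integral do rewrite EFinM.
rewrite ge0_integralZl_EFin//; last 2 first.
- exact: measurable_ball.
- exact: measurable_funTS.
move: hn; rewrite /davg /iavg (lebesgue_measure_ball _ (ltW r0)).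
rewrite inver gt_eqF ?mulrn_wgt0// lte_pdivrMl ?mulrn_wgt0// -EFinM => /ltW hn.
apply: le_trans (lee_wpmul2l _ hn) _; first by rewrite lee_fin ltW.
rewrite -EFinM lee_fin.
rewrite (_ : N * _ = e)//; field; rewrite gt_eqF//.
Unshelve. all: by end_near. Qed.

(** Test the weak derivative against [bump n a b]: one side tends to u(a) - u(b) because [a] and [b]
    are Lebesgue points, the other to minus the integral of [g] over ]a, b] by dominated
    convergence. *)
Lemma weak_deriv_increment u g a b : L2 u -> L2 g -> weak_deriv u g ->
  lebesgue_pt u a -> lebesgue_pt u b -> a < b ->
  u b - u a = \int[mu]_x (g x * \1_`]a, b] x).
Proof.
move=> Lu Lg ug ua ub ab.
have h1 : (fun n => \int[mu]_x (u x * derive1 (bump n.+1%:R a b) x)) @ \oo --> u a - u b.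
  rewrite (_ : (fun n => _) = (fun n => \int[mu]_x (u x * kern n.+1%:R a x) -
      \int[mu]_x (u x * kern n.+1%:R b x))).
    by apply: cvgB; exact: kern_cvg.
  apply/funext => n; rewrite derive1_bump -RintegralB//.
  - by apply: eq_Rintegral => x _; rewrite mulrBr.
  - by apply: L2_integrable_mul => //; exact: L2_kern.
  - by apply: L2_integrable_mul => //; exact: L2_kern.
have h2 : (fun n => \int[mu]_x (g x * bump n.+1%:R a b x)) @ \oo -->
    \int[mu]_x (g x * \1_`]a, b] x).
  (* The descending layer of the bump is [b, b + 2/n] with n >= 1, hence the fixed margin 2. *)
  apply: (@Rintegral_dominated_cvg _ _ (fun x => `|g x| * \1_`[a, b + 2] x)).
  - move=> n; apply: measurable_funM; first exact: L2_measurable.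
    by apply: L2_measurable; apply: (test_fun_L2 _).1; exact: test_fun_bump.
  - move=> x; apply: cvgM; first exact: cvg_cst.
    rewrite /bump; case: (leP x a) => [xa|ax].
      rewrite indicE memNset ?mulr0n; last by rewrite /= in_itv/= ltNge xa.
      under eq_fun do rewrite !stepn_left// ?(le_trans xa (ltW ab))// subrr.
      exact: cvg_cst.
    have stepn_cvg c : c < x -> stepn n.+1%:R c x @[n --> \oo] --> (1 : R).
      move=> cx; apply: cvg_near_cst.
      exists (Num.truncn (2 / (x - c))).+1 => // n /= dn.
      rewrite stepn_right// -lerBrDl ler_pdivrMr// -ler_pdivrMl ?subr_gt0// mulrC.
      by apply: ltW; apply: lt_le_trans (truncnS_gt _) _; rewrite ler_nat (leq_trans dn).
    case: (leP x b) => [xb|bx].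
      rewrite indicE mem_set; last by rewrite /= in_itv/= ax.
      under eq_fun do rewrite (stepn_left _ xb)// subr0.
      exact: stepn_cvg.
    rewrite indicE memNset; last by rewrite /= in_itv/= ax leNgt bx.
    by rewrite -[X in _ --> X](subrr (1 : R)); apply: cvgB; exact: stepn_cvg.
  - move=> n x; rewrite normrM ler_wpM2l// indicE.
    have n0 : 0 < n.+1%:R :> R by [].
    have n2 : 2 / n.+1%:R <= 2 :> R by rewrite ler_pdivrMr// ler_peMr// ler1n.
    case: (boolP (x \in _)) => xI.
      rewrite /= ler_norml /bump; have := @step_ge0 R; have := @step_le1 R => h0 h1'.
      have := h0 (n.+1%:R * (x - a)); have := h0 (n.+1%:R * (x - b)).
      have := h1' (n.+1%:R * (x - a)); have := h1' (n.+1%:R * (x - b)).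
      by rewrite /stepn; move: (step _) (step _) => s t *; apply/andP; split; lra.
    have : ~~ (a <= x <= b + 2) by apply: contra xI => xI; rewrite inE/= in_itv.
    rewrite negb_and -!ltNge => /orP[xa|bx].
      by rewrite /bump !stepn_left ?subrr ?normr0// ltW// (lt_trans xa).
    have bx' : b + 2 / n.+1%:R <= x by rewrite (le_trans _ (ltW bx))// lerD2l.
    have ax' : a + 2 / n.+1%:R <= x by rewrite (le_trans _ bx')// lerD2r ltW.
    by rewrite /bump !stepn_right ?subrr ?normr0.
  - apply: (@eq_Rintegrable _ (fun x => `|g x * \1_`[a, b + 2] x|)).
      by move=> x; rewrite normrM [`|\1__ _|]ger0_norm.
    apply: integrable_norm; apply: L2_integrable_mul => //; exact: L2_indic_itv.
have h3 : (fun n => \int[mu]_x (u x * derive1 (bump n.+1%:R a b) x)) =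
    (fun n => - \int[mu]_x (g x * bump n.+1%:R a b x)).
  by apply/funext => n; apply: ug; exact: test_fun_bump.
rewrite h3 in h1.
apply: oppr_inj; rewrite opprB.
exact: (cvg_unique _ h1 (cvgN h2)).
Qed.

End weak_derivative.

(** * The space H^1 *)

Section almost_everywhere.
Context {R : realType}.
Local Notation mu := (@lebesgue_measure R).

Lemma ae_exists_itv (P : R -> Prop) (a b : R) : (\forall x \ae mu, P x) -> a < b ->
  exists x, a < x < b /\ P x.
Proof.
move=> [N [mN N0 PN]] ab; apply: contrapT => /forallNP h.
have sub : `]a, b[ `<=` N.
  move=> x /=; rewrite in_itv/= => xab; apply: PN => /= Px.
  by apply: (h x).
have : (mu `]a, b[ <= mu N)%E by apply: le_measure; rewrite ?inE.
by rewrite N0 lebesgue_measure_itv/= lte_fin ab -EFinB lee_fin subr_le0 leNgt ab.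
Qed.

Lemma le_Rintegrable_ae (f g : R -> R) : measurable_fun setT f ->
  (\forall x \ae mu, `|f x| <= g x) -> Rintegrable g -> Rintegrable f.
Proof.
move=> mf fg Ig; apply/integrableP; split; first exact/measurable_EFinP.
have mg : measurable_fun setT (fun x => `|g x|).
  by apply: measurableT_comp => //; exact: Rintegrable_measurable.
have maf : measurable_fun setT (fun x => `|f x|) by exact: measurableT_comp.
have Im : Rintegrable (fun x => Num.min `|f x| `|g x|).
  apply: (@le_Rintegrable _ _ (fun x => `|g x|)).
  - exact: measurable_minr.
  - by move=> x; rewrite ger0_norm ?ge_min ?lexx ?orbT// le_min !normr_ge0.
  - exact: integrable_norm.
have -> : (\int[mu]_x `|(EFin \o f) x| = \int[mu]_x (Num.min `|f x| `|g x|)%:E)%E.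
  apply: ae_eq_integral => //.
  - exact/measurable_EFinP.
  - by apply/measurable_EFinP; exact: measurable_minr.
  - move: fg; apply: ae_sub => x /= fg _.
    by rewrite min_l// (le_trans fg)// ler_norm.
by rewrite -EFin_Rintegral// ltry.
Qed.

(** The sequence is Cauchy along [F] itself, so finitely many such conditions hold together on an
    intersection of members of [F], and no subsequences are extracted. *)
Lemma ultra_bounded_cauchy (y : nat -> R) (B : R) (F : set_system nat) :
  UltraFilter F -> (forall n, `|y n| <= B) -> forall eta : R, 0 < eta ->
  exists A, F A /\ forall n k, A n -> A k -> `|y n - y k| <= eta.
Proof.
move=> UF yB eta eta0.
have [x [_ xc]] : `[- B, B] `&` cluster (y @ F) !=set0.
  apply: segment_compact; apply: (@filterS _ F _ setT); last exact: filterT.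
  by move=> n _ /=; rewrite in_itv/= -ler_norml.
exists (y @^-1` ball x (eta / 2)); split.
  have [//|h] := in_ultra_setVsetC (y @^-1` ball x (eta / 2)) UF.
  have [z [zn zb]] := xc (~` ball x (eta / 2)) (ball x (eta / 2)) h
    (nbhsx_ballx x (eta / 2) ltac:(by rewrite divr_gt0)).
  by have := zn zb.
move=> n k; rewrite /ball/= => hn hk.
rewrite (_ : y n - y k = (x - y k) - (x - y n)); last by ring.
apply: le_trans (ler_normB _ _) _; lra.
Qed.

End almost_everywhere.

Section H1_space.
Context {R : realType}.
Local Notation mu := (@lebesgue_measure R).
Implicit Types (u g f : R -> R) (a b x : R).

Lemma L2_locally_integrable f : L2 f -> locally_integrable setT f.
Proof.
move=> Lf; split=> [|//|K _ cK]; [exact: L2_measurable|exact: openT|].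
have [M [_ KM]] := compact_bounded cK.
have mK := compact_measurable cK.
have KI : K `<=` `[- (`|M| + 1), `|M| + 1].
  move=> z Kz /=; rewrite in_itv/= -ler_norml.
  by apply: KM => //; rewrite ltr_pwDr// ler_norm.
have I1 : Rintegrable (fun x => f x * \1_`[- (`|M| + 1), `|M| + 1] x).
  by apply: L2_integrable_mul => //; exact: L2_indic_itv.
case/integrableP: I1 => _; apply: le_lt_trans.
rewrite integral_mkcond; apply: ge0_le_integral => //.
- by move=> x _; rewrite patchE; case: ifP.
- apply/(measurable_restrictT _ _).1 => //.
  by apply: measurable_funTS; apply/measurable_EFinP; apply: measurableT_comp => //; exact: L2_measurable.
- apply/measurable_EFinP; apply: measurableT_comp => //.
  apply: measurable_funM => //; exact: L2_measurable.
- move=> x _; rewrite patchE; case: ifPn => [|_]; last by rewrite lee_fin.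
  rewrite inE => Kx.
  by rewrite /= indicE mem_set ?mulr1//; exact: KI.
Qed.

Lemma L2_lebesgue_pt f : L2 f -> \forall x \ae mu, lebesgue_pt f x.
Proof. by move=> Lf; apply: lebesgue_differentiation; exact: L2_locally_integrable. Qed.

(** Increments of the zero function vanish, so the primitive of [g] starting at [x - 1] is
    identically 0; differentiating it at a Lebesgue point gives g(x) = 0. This amounts to uniqueness
    of weak derivatives. *)
Lemma weak_deriv0_eq0 g : L2 g -> weak_deriv (fun=> 0) g -> \forall x \ae mu, g x = 0.
Proof.
move=> Lg g0; have := L2_lebesgue_pt Lg; apply: ae_sub => x gx.
have pt0 c : lebesgue_pt (fun=> 0 : R) c.
  apply: (@continuous_lebesgue_pt _ _ _ setT) => //; last exact: cvg_cst.
  by split => //; exact: openT.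
have gI a b : Rintegrable (fun x => g x * \1_`]a, b] x).
  by apply: L2_integrable_mul => //; exact: L2_indic_itv.
have F0 y : \int[mu]_(t in `]x - 1, y]) g t = 0.
  have [yx|yx] := leP y (x - 1).
    by rewrite set_itv_ge ?Rintegral_set0// bnd_simp -leNgt.
  rewrite Rintegral_mkcond.
  have e : (0 : R) - 0 = \int[mu]_t (g t * \1_`]x - 1, y] t).
    exact: weak_deriv_increment L2_0 Lg g0 (pt0 (x - 1)) (pt0 y) yx.
  rewrite subrr in e; rewrite [RHS]e; apply: eq_Rintegral => z _.
  by rewrite patchE indicE; case: ifP; rewrite ?mulr1 ?mulr0.
have x1 : x < x + 1 by rewrite ltrDl.
have xx : (BRight (x - 1) < BRight x)%O by rewrite bnd_simp ltrBlDr.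
have [|_] := @FTC1_lebesgue_pt _ g (BRight (x - 1)) x (x + 1) x1 _ xx gx.
  apply/(integrable_mkcond _ _).2 => //.
  apply: (@eq_integrable _ _ _ _ _ measurableT) (gI (x - 1) (x + 1)) => z _.
  by rewrite patchE/= indicE; case: ifP; rewrite ?mulr1 ?mulr0.
rewrite (_ : (fun y => _) = cst 0); last by apply/funext => y; exact: F0.
by rewrite derive1_cst.
Qed.

Lemma weak_derivD u g v h : L2 u -> L2 g -> L2 v -> L2 h ->
  weak_deriv u g -> weak_deriv v h -> weak_deriv (u + v) (g + h).
Proof.
move=> Lu Lg Lv Lh ug vh phi tphi; have [L1 L1'] := test_fun_L2 tphi.
rewrite (_ : \int[mu]_x _ = \int[mu]_x (u x * (derive1 phi) x + v x * (derive1 phi) x)).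
  rewrite RintegralD//; [|exact: L2_integrable_mul..].
  rewrite ug// vh// -opprD -RintegralD//; [|exact: L2_integrable_mul..].
  by congr (- _); apply: eq_Rintegral => x _; rewrite mulrDl.
by apply: eq_Rintegral => x _; rewrite mulrDl.
Qed.

Lemma weak_derivZ (c : R) u g : L2 u -> L2 g ->
  weak_deriv u g -> weak_deriv (c *: u) (c *: g).
Proof.
move=> Lu Lg ug phi tphi; have [L1 L1'] := test_fun_L2 tphi.
rewrite (_ : \int[mu]_x _ = \int[mu]_x (c * (u x * (derive1 phi) x))).
  rewrite RintegralZl//; last exact: L2_integrable_mul.
  rewrite ug// mulrN -RintegralZl//; last exact: L2_integrable_mul.
  by congr (- _); apply: eq_Rintegral => x _; rewrite mulrA.
by apply: eq_Rintegral => x _; rewrite mulrA.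
Qed.

Definition H1_pred : {pred (@L2t R * @L2t R)} := fun p => `[< weak_deriv p.1 p.2 >].

Lemma H1_submod : submod_closed H1_pred.
Proof.
split.
  apply/asboolP => phi tphi.
  rewrite (@eq_Rintegral _ _ _ _ _ (fun=> 0)) => [|x _]; last by rewrite [L2_fun _ _]/(0 : R) mul0r.
  rewrite [in RHS](@eq_Rintegral _ _ _ _ _ (fun=> 0)) => [|x _]; last by rewrite [L2_fun _ _]/(0 : R) mul0r.
  by rewrite Rintegral_cst//= mul0r oppr0.
move=> c f g /asboolP Lf /asboolP Lg; apply/asboolP.
have e1 : L2_fun (c *: f + g).1 = c *: L2_fun f.1 + L2_fun g.1.
  by rewrite -L2_fun_scale -L2_fun_add.
have e2 : L2_fun (c *: f + g).2 = c *: L2_fun f.2 + L2_fun g.2.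
  by rewrite -L2_fun_scale -L2_fun_add.
rewrite e1 e2; apply: weak_derivD (L2Z c (L2tP f.1)) (L2Z c (L2tP f.2)) (L2tP g.1) (L2tP g.2) _ Lg.
exact: weak_derivZ (L2tP f.1) (L2tP f.2) Lf.
Qed.

HB.instance Definition _ := GRing.isSubmodClosed.Build R (@L2t R * @L2t R)%type H1_pred H1_submod.

(** H^1 as the graph of the weak derivative inside L^2 x L^2: the module structure is inherited, and
    the derivative is a linear projection instead of a choice. *)
Definition H1t := {p : @L2t R * @L2t R | p \in H1_pred}.
HB.instance Definition _ := SubType.on H1t.
HB.instance Definition _ := Choice.on H1t.
HB.instance Definition _ := [SubChoice_isSubLmodule of H1t by <:].

Definition H1_val (h : H1t) : L2t := (val h).1.
Definition H1_der (h : H1t) : L2t := (val h).2.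
Coercion H1_val : H1t >-> L2t.

Lemma H1tP (h : H1t) : weak_deriv (H1_val h) (H1_der h).
Proof. by apply/asboolP; exact: (valP h). Qed.

Lemma H1_valD (u v : H1t) : H1_val (u + v) = H1_val u + H1_val v.
Proof. by rewrite /H1_val raddfD. Qed.

Lemma H1_derD (u v : H1t) : H1_der (u + v) = H1_der u + H1_der v.
Proof. by rewrite /H1_der raddfD. Qed.

Lemma H1_valZ c (u : H1t) : H1_val (c *: u) = c *: H1_val u.
Proof. by rewrite /H1_val linearZ. Qed.

Lemma H1_derZ c (u : H1t) : H1_der (c *: u) = c *: H1_der u.
Proof. by rewrite /H1_der linearZ. Qed.

Lemma H1_valB (u v : H1t) : H1_val (u - v) = H1_val u - H1_val v.
Proof. by rewrite /H1_val raddfB. Qed.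

Lemma H1_derB (u v : H1t) : H1_der (u - v) = H1_der u - H1_der v.
Proof. by rewrite /H1_der raddfB. Qed.

Definition toH1 u g (Lu : L2 u) (Lg : L2 g) (ug : weak_deriv u g) : H1t :=
  exist _ (toL2 Lu, toL2 Lg) (introT (asboolP _) ug).

Definition mass_form (u v : H1t) : R := L2_ip (H1_val u) (H1_val v).
Definition energy_form (u v : H1t) : R := L2_ip (H1_der u) (H1_der v).
Definition q_form (beta : R) (u v : H1t) : R := energy_form u v + beta * mass_form u v.

Lemma mass_form_sym_bilinear : sym_bilinear mass_form.
Proof.
have B := @L2_ip_sym_bilinear R.
split=> [u v|u v w|c u v]; rewrite /mass_form.
- exact: (formC B).
- by rewrite H1_valD (formDl B).
- by rewrite H1_valZ (formZl B).
Qed.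

Lemma energy_form_sym_bilinear : sym_bilinear energy_form.
Proof.
have B := @L2_ip_sym_bilinear R.
split=> [u v|u v w|c u v]; rewrite /energy_form.
- exact: (formC B).
- by rewrite H1_derD (formDl B).
- by rewrite H1_derZ (formZl B).
Qed.

Lemma mass_form_ge0 (u : H1t) : 0 <= mass_form u u. Proof. exact: L2_ip_ge0. Qed.
Lemma energy_form_ge0 (u : H1t) : 0 <= energy_form u u. Proof. exact: L2_ip_ge0. Qed.

Lemma q_form_sym_bilinear beta : sym_bilinear (q_form beta).
Proof.
have A := energy_form_sym_bilinear; have B := mass_form_sym_bilinear.
split=> *; rewrite /q_form.
- by rewrite (formC A) (formC B).
- by rewrite (formDl A) (formDl B); ring.
- by rewrite (formZl A) (formZl B); ring.
Qed.

Lemma q_form_ge0 beta (u : H1t) : 0 < beta -> 0 <= q_form beta u u.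
Proof.
move=> b0; apply: addr_ge0; first exact: energy_form_ge0.
by rewrite mulr_ge0 ?mass_form_ge0// ltW.
Qed.

End H1_space.

(** * Compactness of the potential *)

Section H1_pointwise.
Context {R : realType}.
Local Notation mu := (@lebesgue_measure R).
Implicit Types (u v : @H1t R) (a b x : R).

Lemma H1_lebesgue_pt u : \forall x \ae mu, lebesgue_pt u x.
Proof. exact: L2_lebesgue_pt (L2tP _). Qed.

Lemma Rintegral_indic_itv (b1 b2 : bool) a b : a <= b ->
  \int[mu]_x (\1_[set` Interval (BSide b1 a) (BSide b2 b)] x) = b - a.
Proof.
move=> ab; rewrite /Rintegral integral_indic// setIT.
have /= -> := @lebesgue_measure_itv R (Interval (BSide b1 a) (BSide b2 b)).
rewrite /= lte_fin.
by move: ab; rewrite le_eqVlt => /orP[/eqP ->|->]; rewrite ?ltxx ?subrr.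
Qed.

Lemma H1_increment_le u a b : lebesgue_pt u a -> lebesgue_pt u b -> a <= b ->
  (u b - u a) ^+ 2 <= (b - a) * energy_form u u.
Proof.
move=> ua ub; rewrite le_eqVlt => /orP[/eqP <-|ab].
  by rewrite !subrr mul0r expr0n.
rewrite (weak_deriv_increment (L2tP _) (L2tP _) (H1tP u) ua ub ab).
have L1 : L2 (\1_`]a, b] : R -> R) by exact: L2_indic_itv.
have -> : b - a = L2_ip (toL2 L1) (toL2 L1).
  rewrite -(Rintegral_indic_itv false false (ltW ab)); apply: eq_Rintegral => x _.
  by rewrite toL2E indicE; case: (_ \in _); rewrite ?mulr1 ?mulr0.
rewrite mulrC.
apply: (@form_CauchySchwarz _ _ (@L2_ip R) (H1_der u) (toL2 L1) L2_ip_sym_bilinear) => t.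
exact: L2_ip_ge0.
Qed.

Lemma H1_increment_norm_le u a b d : lebesgue_pt u a -> lebesgue_pt u b -> `|b - a| <= d ->
  (u b - u a) ^+ 2 <= d * energy_form u u.
Proof.
move=> ua ub; have [ab|/ltW ba] := leP a b => abd.
  apply: le_trans (H1_increment_le ua ub ab) _.
  by rewrite ler_wpM2r ?energy_form_ge0// (le_trans (ler_norm _)).
rewrite -sqrrN opprB; apply: le_trans (H1_increment_le ub ua ba) _.
by rewrite ler_wpM2r ?energy_form_ge0// (le_trans (ler_norm _))// distrC.
Qed.

(** Average u(a)^2 <= 2 u(x)^2 + 2 (u(a) - u(x))^2 over x in [a, a + 1], where the squared increment
    is at most the energy. *)
Lemma H1_value_le u a : lebesgue_pt u a ->
  u a ^+ 2 <= 2 * mass_form u u + 2 * energy_form u u.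
Proof.
move=> ua; set A := energy_form u u.
have A0 : 0 <= A by exact: energy_form_ge0.
pose I : R -> R := \1_`[a, a + 1].
have L1 : L2 I by exact: L2_indic_itv.
have I01 x : 0 <= I x <= 1.
  by rewrite /I indicE; case: (_ \in _); rewrite ?lexx ?ler01.
have Isq : (fun x => I x * I x) =1 I.
  by move=> x; rewrite /I indicE; case: (_ \in _); rewrite ?mulr1 ?mulr0.
have II : Rintegrable I by exact: eq_Rintegrable Isq (L2_integrable_mul L1 L1).
have I1 : \int[mu]_x I x = 1.
  by rewrite Rintegral_indic_itv ?lerDl// addrC addKr.
have Iu : Rintegrable (fun x => u x ^+ 2) by exact: L2_integrable_sqr (L2tP _).
have : \int[mu]_x (u a ^+ 2 * I x) <= \int[mu]_x (2 * u x ^+ 2 + 2 * A * I x).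
  apply: Rintegral_le_ae.
  - exact: RintegrableZ.
  - by apply: RintegrableD; exact: RintegrableZ.
  - have := H1_lebesgue_pt u; apply: ae_sub => x ux.
    have /andP[i0 i1] := I01 x.
    have [xI|xI] := boolP (x \in `[a, a + 1]).
      have -> : I x = 1 by rewrite /I indicE mem_set.
      have := @H1_increment_norm_le u x a 1 ux ua.
      move: xI; rewrite in_itv/= => /andP[ax xa].
      rewrite ler0_norm ?subr_le0// => h.
      have := h ltac:(by lra); rewrite -/A mul1r.
      have := sqr_ge0 (u a - u x - u x); nra.
    have -> : I x = 0.
      by rewrite /I indicE memNset// => h; move/negP: xI; apply.
    by rewrite !mulr0 addr0 mulr_ge0 ?sqr_ge0.
rewrite RintegralZl// I1 mulr1 RintegralD//; [|exact: RintegrableZ..].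
by rewrite !RintegralZl// I1 mulr1 /mass_form L2_ipE.
Qed.

End H1_pointwise.

Section potential_form.
Context {R : realType}.
Local Notation mu := (@lebesgue_measure R).
Implicit Types (u v : @H1t R) (a b x : R).
Variables (V : R -> R) (C : R).
Hypothesis mV : measurable_fun setT V.
Hypothesis C0 : 0 <= C.
Hypothesis VC : \forall x \ae mu, `|V x| <= C.

Definition V_form u v : R := \int[mu]_x (V x * u x * v x).

Lemma L2_potential (f : R -> R) : L2 f -> L2 (fun x => V x * f x).
Proof.
move=> Lf; apply/L2P; split; first by apply: measurable_funM => //; exact: L2_measurable.
apply: (@le_Rintegrable_ae _ _ (fun x => C ^+ 2 * f x ^+ 2)).
- by apply: measurable_funX; apply: measurable_funM => //; exact: L2_measurable.
- move: VC; apply: ae_sub => x Vx; rewrite normrX normrM exprMn (real_normK (num_real (f x))).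
  by rewrite ler_wpM2r ?sqr_ge0// lerXn2r// nnegrE.
- by apply: RintegrableZ; exact: L2_integrable_sqr.
Qed.

Lemma Rintegrable_potential (f g : R -> R) : L2 f -> L2 g ->
  Rintegrable (fun x => V x * f x * g x).
Proof. by move=> Lf Lg; apply: L2_integrable_mul => //; exact: L2_potential. Qed.

Lemma V_form_sym_bilinear : sym_bilinear V_form.
Proof.
split=> [u v|u v w|c u v]; rewrite /V_form.
- by apply: eq_Rintegral => x _; ring.
- rewrite -RintegralD//; [|exact: Rintegrable_potential (L2tP _) (L2tP _)..].
  by apply: eq_Rintegral => x _; rewrite H1_valD L2_funD; ring.
- rewrite -RintegralZl//; [|exact: Rintegrable_potential (L2tP _) (L2tP _)].
  by apply: eq_Rintegral => x _; rewrite H1_valZ L2_funZ; ring.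
Qed.

Lemma V_form_bounded u : `|V_form u u| <= C * mass_form u u.
Proof.
rewrite /mass_form L2_ipE -RintegralZl//; last exact: L2_integrable_sqr (L2tP _).
have IV := Rintegrable_potential (L2tP u) (L2tP u).
apply: le_trans (le_normr_Rintegral _ _) _ => //.
apply: Rintegral_le_ae; first exact: integrable_norm.
  by apply: RintegrableZ; exact: L2_integrable_sqr (L2tP _).
move: VC; apply: ae_sub => x Vx.
by rewrite -mulrA normrM -expr2 [`|_ ^+ 2|]ger0_norm ?sqr_ge0// ler_wpM2r ?sqr_ge0.
Qed.

Hypothesis V_pinfty : V x @[x --> +oo] --> 0.
Hypothesis V_ninfty : V x @[x --> -oo] --> 0.

Lemma V_small_outside (e : R) : 0 < e -> exists M : R, 0 < M /\ forall x, M < `|x| -> `|V x| <= e.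
Proof.
move=> e0.
have /cvgr0Pnorm_le/(_ e e0)[M1 [_ h1]] := V_pinfty.
have /cvgr0Pnorm_le/(_ e e0)[M2 [_ h2]] := V_ninfty.
exists (`|M1| + `|M2| + 1); split.
  by rewrite ltr_wpDl.
move=> x; rewrite lter_normr => /orP[xM|xM].
  apply: h1; apply: le_lt_trans xM.
  have := ler_norm M1; have := normr_ge0 M2; lra.
apply: h2; have := ler_norm (- M2); rewrite normrN; have := normr_ge0 M1; lra.
Qed.

(** Outside [-M, M] the potential is small. Inside, closeness of two functions at the points of a
    finite grid spreads to the whole interval by the increment bound, and along an ultrafilter
    closeness on a finite grid comes for free. *)
Lemma V_form_compact (beta : R) : 0 < beta -> forall u : nat -> @H1t R,
  (forall n, q_form beta (u n) (u n) <= 1) ->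
  forall F, UltraFilter F -> forall eps : R, 0 < eps ->
  exists A, F A /\ forall n k, A n -> A k ->
    - eps <= V_form (u n - u k) (u n - u k).
Proof.
move=> b0 u uq F UF eps eps0.
have um n : mass_form (u n) (u n) <= beta^-1.
  rewrite -[leRHS]mulr1 ler_pdivlMl//.
  by apply: le_trans (uq n); rewrite lerDr energy_form_ge0.
have ue n : energy_form (u n) (u n) <= 1.
  by apply: le_trans (uq n); rewrite lerDl mulr_ge0 ?mass_form_ge0// ltW.
have B_sub (f : @H1t R -> @H1t R -> R) c v w : sym_bilinear f -> (forall z, 0 <= f z z) ->
    f v v <= c -> f w w <= c -> f (v - w) (v - w) <= 4 * c.
  move=> fB f0 fv fw; have := form_parallelogram fB v w.
  have := f0 (v + w); lra.
have dm n k := B_sub _ _ _ _ mass_form_sym_bilinear (@mass_form_ge0 R) (um n) (um k).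
have de n k := B_sub _ _ _ _ energy_form_sym_bilinear (@energy_form_ge0 R) (ue n) (ue k).
(* Differences have mass at most 4 / beta, so the part outside [-M, M] costs at most eps / 2. *)
pose e1 := eps * beta / 8.
have e10 : 0 < e1 by rewrite /e1 !mulr_gt0.
have [M [M0 VM]] := V_small_outside e10.
(* on [-M, M] we want [(u n - u k) ^+ 2 <= d2] *)
pose d2 : R := eps / (4 * M * (C + 1)).
have C1 : 0 < C + 1 by rewrite ltr_wpDl.
have d20 : 0 < d2 by rewrite /d2 divr_gt0// !mulr_gt0.
(* Differences [w] have energy at most 4, so an increment over distance [d] has square at most d2 /
   4. With the square of [w] at the grid point also at most d2 / 4, w(x)^2 <= 2 w(p)^2 + 2 (w(x) -
   w(p))^2 gives [d2]. *)
pose d : R := d2 / 16.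
have d0 : 0 < d by rewrite divr_gt0.
pose P x := (forall n, lebesgue_pt (u n) x) /\ forall n k, lebesgue_pt (H1_val (u n - u k)) x.
have aeP : \forall x \ae mu, P x.
  apply: ae_and; first by apply: ae_forall_nat => n; exact: H1_lebesgue_pt.
  apply: ae_forall_nat => n; apply: ae_forall_nat => k; exact: H1_lebesgue_pt.
(* The grid points cannot be prescribed, since only almost every point is a Lebesgue point of all
   functions involved; one such point is taken in each cell of length [d]. *)
have /choice[p pP] : forall i : nat, exists x,
    (- M + i%:R * d < x < - M + i%:R * d + d) /\ P x.
  by move=> i; apply: ae_exists_itv => //; rewrite ltrDl.
(* The minimum with 1 lets a bound on the absolute value bound the square, without a square root. *)
pose eta : R := Num.min 1 (d2 / 4).
have eta0 : 0 < eta by rewrite lt_min ltr01 divr_gt0.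
have pc i : exists A, F A /\ forall n k, A n -> A k -> `|u n (p i) - u k (p i)| <= eta.
  apply: (@ultra_bounded_cauchy _ (fun n => u n (p i)) (2 * beta^-1 + 2 + 1)) => // n.
  have [_ [Pp _]] := pP i.
  have h1 := H1_value_le (Pp n); have h2 := um n; have h3 := ue n.
  have h4 : u n (p i) ^+ 2 <= 2 * beta^-1 + 2 by lra.
  have h5 := sqr_ge0 (`|u n (p i)| - 1).
  rewrite sqrrB real_normK ?num_real// in h5.
  have h6 : 0 < beta^-1 by rewrite invr_gt0.
  lra.
pose N := (Num.truncn (2 * M / d)).+1.
have [A [FA AP]] : exists A, F A /\ forall i, (i <= N)%N -> forall n k, A n -> A k ->
    `|u n (p i) - u k (p i)| <= eta.
  elim: N => [|N [A [FA AP]]].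
    have [A [FA AP]] := pc 0%N; exists A; split => // i.
    by rewrite leqn0 => /eqP ->.
  have [A' [FA' AP']] := pc N.+1; exists (A `&` A'); split; first exact: filterI.
  move=> i; rewrite leq_eqVlt ltnS => /orP[/eqP -> n k [_ ?] [_ ?]|iN n k [? _] [? _]].
    exact: AP'.
  exact: AP.
exists A; split => // n k An Ak.
pose w : @H1t R := u n - u k.
have wE x : w x = u n x - u k x by rewrite /w H1_valB L2_funB.
have wae : \forall x \ae mu, `|x| <= M -> w x ^+ 2 <= d2.
  move: aeP; apply: ae_sub => x [_ Px]; rewrite ler_norml => /andP[Mx xM].
  pose i := Num.truncn ((x + M) / d).
  have xMd : 0 <= (x + M) / d by apply: divr_ge0; [lra|exact: ltW].
  have /andP[h1 h2] := truncn_itv xMd.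
  rewrite -/i ler_pdivlMr// in h1; rewrite -/i ltr_pdivrMr// in h2.
  have iN : (i <= N)%N.
    rewrite /N /i leqW//; apply: le_truncn; rewrite ler_pM2r ?invr_gt0//; lra.
  have [/andP[p1 p2] [_ Pp]] := pP i.
  have h3 := H1_increment_norm_le (Pp n k) (Px n k) (d := d).
  rewrite -/w in h3.
  have h4 : `|x - p i| <= d.
    rewrite -natr1 mulrDl mul1r in h2; rewrite ler_norml; apply/andP; split; lra.
  have h5 := h3 h4.
  have h6 : w (p i) ^+ 2 <= d2 / 4.
    have h7 := AP i iN n k An Ak.
    rewrite -wE in h7; rewrite -real_normK ?num_real// expr2.
    have h8 : `|w (p i)| <= 1 by rewrite (le_trans h7)// ge_min lexx.
    have h9 : `|w (p i)| <= d2 / 4 by rewrite (le_trans h7)// ge_min lexx orbT.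
    apply: le_trans h9; rewrite -[leRHS]mul1r ler_wpM2r//.
  have h10 : d * energy_form w w <= d2 / 4.
    apply: (@le_trans _ _ (d * (4 * 1))); first by rewrite ler_pM2l// de.
    by rewrite /d; lra.
  have := sqr_ge0 (w x - 2 * w (p i)); move: h5 h6 h10; nra.
have Iw : Rintegrable (fun x => w x ^+ 2) by exact: L2_integrable_sqr (L2tP _).
pose I : R -> R := \1_`[- M, M].
have II : Rintegrable I by exact: (integrable_indic_itv (- M) M true false).
have IV := Rintegrable_potential (L2tP w) (L2tP w).
have : `|V_form w w| <= \int[mu]_x (e1 * w x ^+ 2 + C * d2 * I x).
  apply: le_trans (le_normr_Rintegral _ _) _ => //.
  apply: Rintegral_le_ae; first exact: integrable_norm.
    by apply: RintegrableD; exact: RintegrableZ.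
  move: (ae_and wae VC); apply: ae_sub => x [wx Vx].
  rewrite -mulrA normrM -expr2 [`|_ ^+ 2|]ger0_norm ?sqr_ge0//.
  have [Mx|xM] := ltP M `|x|.
    rewrite -[leLHS]addr0; apply: lerD; first by rewrite ler_wpM2r ?sqr_ge0// VM.
    apply: mulr_ge0; last by rewrite /I indicE.
    by apply: mulr_ge0 => //; exact: ltW.
  have -> : I x = 1 by rewrite /I indicE mem_set//= in_itv/= -ler_norml.
  rewrite mulr1 -[leLHS]add0r; apply: lerD; first by rewrite mulr_ge0 ?sqr_ge0// ltW.
  by apply: ler_pM => //; [exact: sqr_ge0|exact: wx].
rewrite RintegralD; [|exact: measurableT|exact: RintegrableZ..].
rewrite (RintegralZl e1 measurableT Iw) (RintegralZl (C * d2) measurableT II).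
rewrite (@Rintegral_indic_itv _ true false (- M) M); last by rewrite ge0_cp// ltW.
have -> : \int[mu]_x (w x ^+ 2) = mass_form w w by rewrite /mass_form L2_ipE.
have h1 : e1 * mass_form w w <= eps / 2.
  apply: (@le_trans _ _ (e1 * (4 * beta^-1))); first by rewrite ler_pM2l// dm.
  by rewrite /e1 le_eqVlt; apply/orP; left; apply/eqP; field; rewrite gt_eqF.
have h2 : C * d2 * (M - - M) <= eps / 2.
  rewrite (_ : C * d2 * (M - - M) = C / (C + 1) * (eps / 2)).
    apply: ler_piMl; first by apply: ltW; rewrite divr_gt0.
    by rewrite ler_pdivrMr// mul1r lerDl.
  by rewrite /d2; field; rewrite !gt_eqF.
move=> h3; rewrite lerNl; apply: le_trans (ler_norm _) _; rewrite normrN.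
by apply: le_trans h3 _; rewrite [leRHS]splitr; exact: lerD.
Qed.

End potential_form.

(** * Eigenfunctions of K_beta *)

Section H1_complete.
Context {R : realType}.
Local Notation mu := (@lebesgue_measure R).

(** [q_form beta] controls the mass only up to the factor 1 / beta; dividing by the square root of
    [K] restores the rate that [L2_complete] expects. *)
Lemma L2_complete_scaled (f : nat -> @L2t R) (K : R) : 0 < K ->
  (forall n, L2_ip (f n.+1 - f n) (f n.+1 - f n) <= K * 8^-1 ^+ n) ->
  exists g : L2t, forall eps : R, 0 < eps -> exists N, forall n, (N <= n)%N ->
    L2_ip (f n - g) (f n - g) <= eps.
Proof.
move=> K0 fK; have B := @L2_ip_sym_bilinear R.
pose c := (Num.sqrt K)^-1.
have c2 : c * c = K^-1 by rewrite -expr2 /c exprVn sqr_sqrtr// ltW.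
have c0 : c != 0 by rewrite /c invr_neq0// gt_eqF// sqrtr_gt0.
have scale (u : @L2t R) : L2_ip (c *: u) (c *: u) = K^-1 * L2_ip u u.
  by rewrite (formZl B) (formZr B) mulrA c2.
have [n|g gP] := @L2_complete R (fun n => c *: f n).
  by rewrite -scalerBr scale ler_pdivrMl.
exists (c^-1 *: g) => eps eps0.
have [N NP] := gP (K^-1 * eps) ltac:(by rewrite mulr_gt0// invr_gt0).
exists N => n Nn; have := NP n Nn.
have -> : c *: f n - g = c *: (f n - c^-1 *: g) by rewrite scalerBr scalerKV.
by rewrite scale ler_pM2l// invr_gt0.
Qed.

(** For a fixed test function both sides of the defining identity are L^2-continuous, by
    Cauchy-Schwarz, so the graph of the weak derivative is closed. *)
Lemma weak_deriv_closed (g1 g2 : @L2t R) :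
  (forall eps : R, 0 < eps -> exists h : @H1t R,
    L2_ip (H1_val h - g1) (H1_val h - g1) <= eps /\
    L2_ip (H1_der h - g2) (H1_der h - g2) <= eps) ->
  weak_deriv g1 g2.
Proof.
move=> hP phi tphi; have [L1 L1'] := test_fun_L2 tphi.
have B := @L2_ip_sym_bilinear R.
pose p := toL2 L1; pose p' := toL2 L1'.
rewrite -[LHS]/(L2_ip g1 p') -[X in _ = - X]/(L2_ip g2 p).
apply/eqP; rewrite -addr_eq0 -sqrf_eq0; apply/eqP/le_anti; rewrite sqr_ge0 andbT.
apply/ler_addgt0Pl => eps eps0; rewrite addr0.
pose K := 2 * L2_ip p' p' + 2 * L2_ip p p + 1.
have p0 := L2_ip_ge0 p; have p'0 := L2_ip_ge0 p'.
have K0 : 0 < K by rewrite /K; lra.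
have [h [h1 h2]] := hP (eps / K) ltac:(by rewrite divr_gt0).
have ph : L2_ip (H1_val h) p' = - L2_ip (H1_der h) p by exact: H1tP h _ tphi.
have -> : L2_ip g1 p' + L2_ip g2 p = - (L2_ip (H1_val h - g1) p' + L2_ip (H1_der h - g2) p).
  by rewrite !(formBl B) ph; ring.
have c1 : L2_ip (H1_val h - g1) p' ^+ 2 <= eps / K * L2_ip p' p'.
  apply: le_trans (form_CauchySchwarz B _) _; first by move=> t; exact: L2_ip_ge0.
  by rewrite ler_wpM2r.
have c2 : L2_ip (H1_der h - g2) p ^+ 2 <= eps / K * L2_ip p p.
  apply: le_trans (form_CauchySchwarz B _) _; first by move=> t; exact: L2_ip_ge0.
  by rewrite ler_wpM2r.
rewrite sqrrN.
apply: (@le_trans _ _ (eps / K * K)); last by rewrite divfK// gt_eqF.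
have eK : 0 < eps / K by rewrite divr_gt0.
move: c1 c2 eK; rewrite /K; move: (L2_ip _ p') (L2_ip _ p) (eps / _) => x y z c1 c2 eK.
have := sqr_ge0 (x - y); nra.
Qed.

Lemma q_form_complete (beta : R) (u : nat -> @H1t R) : 0 < beta ->
  (forall n, q_form beta (u n.+1 - u n) (u n.+1 - u n) <= 8^-1 ^+ n) ->
  exists v, forall eps : R, 0 < eps -> exists N, forall n, (N <= n)%N ->
    q_form beta (u n - v) (u n - v) <= eps.
Proof.
move=> b0 uq.
have [n|g1 g1P] := @L2_complete_scaled (fun n => H1_val (u n)) beta^-1 ltac:(by rewrite invr_gt0).
  rewrite ler_pdivlMl// -H1_valB; apply: le_trans (uq n).
  by rewrite lerDr; exact: energy_form_ge0.
have [n|g2 g2P] := @L2_complete_scaled (fun n => H1_der (u n)) 1 ltr01.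
  rewrite mul1r -H1_derB; apply: le_trans (uq n).
  by rewrite lerDl mulr_ge0 ?mass_form_ge0// ltW.
have wg : weak_deriv g1 g2.
  apply: weak_deriv_closed => eps eps0.
  have [N1 N1P] := g1P _ eps0; have [N2 N2P] := g2P _ eps0.
  exists (u (maxn N1 N2)); split; [apply: N1P|apply: N2P]; [exact: leq_maxl|exact: leq_maxr].
pose v : H1t := exist _ (g1, g2) (introT (asboolP _) wg).
exists v => eps eps0.
have [N1 N1P] := g1P (eps / (2 * beta)) ltac:(by rewrite divr_gt0// mulr_gt0).
have [N2 N2P] := g2P (eps / 2) ltac:(by rewrite divr_gt0).
exists (maxn N1 N2) => n; rewrite geq_max => /andP[n1 n2].
have h1 : mass_form (u n - v) (u n - v) <= eps / (2 * beta).
  by rewrite /mass_form H1_valB; exact: N1P.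
have h2 : energy_form (u n - v) (u n - v) <= eps / 2.
  by rewrite /energy_form H1_derB; exact: N2P.
rewrite /q_form [leRHS]splitr; apply: lerD => //.
rewrite -ler_pdivlMl//; apply: le_trans h1 _.
by rewrite le_eqVlt; apply/orP; left; apply/eqP; field; rewrite gt_eqF.
Qed.

(** Bridges the statements quantifying over every weak derivative of [u] and the forms, which use
    the derivative stored in [H1t]. *)
Lemma weak_deriv_unique (u : @H1t R) (g f : R -> R) : L2 g -> L2 f -> weak_deriv u g ->
  \int[mu]_x (g x * f x) = \int[mu]_x (H1_der u x * f x).
Proof.
move=> Lg Lf ug.
have Lu := L2tP (H1_val u); have Ldu := L2tP (H1_der u).
have gd0 : weak_deriv (fun=> 0) (g + (-1) *: L2_fun (H1_der u)).
  have := weak_derivD Lu Lg (L2Z (-1) Lu) (L2Z (-1) Ldu) ug (weak_derivZ (-1) Lu Ldu (H1tP u)).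
  by congr weak_deriv; apply/funext => x; rewrite !fctE scaleN1r subrr.
have := weak_deriv0_eq0 (L2D Lg (L2Z (-1) Ldu)) gd0 => gd.
apply: Rintegral_ae.
- by apply: measurable_funM; exact: L2_measurable.
- by apply: measurable_funM; exact: L2_measurable.
- move: gd; apply: ae_sub => x; rewrite !fctE scaleN1r => /eqP.
  by rewrite subr_eq0 => /eqP ->.
Qed.

End H1_complete.

Section eigenvalues.
Context {R : realType}.
Local Notation mu := (@lebesgue_measure R).
Implicit Types (u v : @H1t R) (a b x : R).
Variables (V : R -> R).

Lemma H1E (f : R -> R) : H1 f <-> exists u : H1t, L2_fun (H1_val u) = f.
Proof.
split=> [[Lf [g [Lg fg]]]|[u <-]]; first by exists (toH1 Lf Lg fg).
by split; [exact: L2tP|exists (H1_der u); split; [exact: L2tP|exact: H1tP]].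
Qed.

Lemma KeigP beta m (f : R -> R) : Keig V beta m f <->
  exists2 u : H1t, L2_fun (H1_val u) = f & form_eigen (q_form beta) (V_form V) m u.
Proof.
split=> [[/H1E[u uf] [_ h]]|[u uf ue]].
  exists u => // v.
  have := h (L2_fun (H1_der (m *: u))) (L2tP _).
  have -> : (fun x => m * f x) = L2_fun (H1_val (m *: u)).
    by rewrite H1_valZ -uf; apply/funext => x; rewrite L2_funZ.
  move=> /(_ (H1tP (m *: u)) (L2_fun (H1_val v)) (L2_fun (H1_der v))).
  move=> /(_ ((H1E _).2 (ex_intro _ v erefl)) (L2tP _) (H1tP v)).
  rewrite -uf => e; rewrite -(formZl (q_form_sym_bilinear beta)).
  by rewrite /V_form -e.
subst f; have mf : L2_fun (H1_val (m *: u)) = (fun x => m * u x).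
  by rewrite H1_valZ; apply/funext => x; rewrite L2_funZ.
split; first by apply/H1E; exists u.
split; first by apply/H1E; exists (m *: u).
move=> dw Ldw wdw v dv [Lv _] Ldv vdv.
have := ue (toH1 Lv Ldv vdv); rewrite -(formZl (q_form_sym_bilinear beta)) => e.
rewrite -mf in wdw *.
by rewrite /ip_beta (weak_deriv_unique Ldw Ldv wdw); exact: esym e.
Qed.

Lemma solves_astP (l : R) (f : R -> R) : solves_ast V l f <->
  exists2 u : H1t, L2_fun (H1_val u) = f &
    forall v, q_form (1 - l ^+ 2) u v = - ((1 - l) * V_form V u v).
Proof.
split=> [[/H1E[u uf] h]|[u uf ue]].
  exists u => // v; rewrite -uf in h.
  exact: h _ (L2tP _) (H1tP u) _ _ ((H1E _).2 (ex_intro _ v erefl)) (L2tP _) (H1tP v).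
split; first by apply/H1E; exists u.
rewrite -uf => dw Ldw wdw v dv [Lv _] Ldv vdv.
by rewrite (weak_deriv_unique Ldw Ldv wdw); exact: ue (toH1 Lv Ldv vdv).
Qed.

Lemma solves_ast_Keig (l : R) f : l < 1 ->
  solves_ast V l f <-> Keig V (1 - l ^+ 2) (- (1 - l)^-1) f.
Proof.
move=> l1; have l0 : 1 - l != 0 by rewrite subr_eq0 gt_eqF.
split=> [/solves_astP[u uf ue]|/KeigP[u uf ue]].
  by apply/KeigP; exists u => // v; rewrite ue mulrNN mulKf.
by apply/solves_astP; exists u => // v; rewrite ue mulNr mulrN opprK mulVKf.
Qed.

Lemma lincomb_H1 k c (f : nat -> @H1t R) x :
  L2_fun (H1_val (lincomb k c f)) x = \sum_(i < k) c i * f i x.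
Proof.
elim: k => [|k IH]; first by rewrite /lincomb !big_ord0 /H1_val raddf0.
by rewrite lincombS big_ord_recr/= H1_valD L2_funD IH H1_valZ L2_funZ.
Qed.

Variable C : R.
Hypothesis mV : measurable_fun setT V.
Hypothesis C0 : 0 <= C.
Hypothesis VC : \forall x \ae mu, `|V x| <= C.
Hypothesis V_pinfty : V x @[x --> +oo] --> 0.
Hypothesis V_ninfty : V x @[x --> -oo] --> 0.

Local Notation q := (@q_form R).
Local Notation VF := (V_form V).
Let qB (beta : R) : sym_bilinear (q beta) := q_form_sym_bilinear beta.
Let VB : sym_bilinear VF := V_form_sym_bilinear mV C0 VC.

Let V_bounded beta : 0 < beta ->
  exists C' : R, 0 <= C' /\ forall u, `|VF u u| <= C' * q beta u u.
Proof.
move=> b0; exists (C / beta); split; first by rewrite divr_ge0// ltW.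
move=> u; apply: le_trans (V_form_bounded mV C0 VC u) _.
rewrite -mulrA ler_wpM2l// ler_pdivlMl//.
by rewrite lerDr; exact: energy_form_ge0.
Qed.

Lemma spectral_family beta k (t : R) : 0 < beta -> t < 0 ->
  subspace_le (q beta) VF t k ->
  exists e ms, [/\ form_orthonormal (q beta) k e,
    forall i, (i < k)%N -> form_eigen (q beta) VF (ms i) (e i) &
    forall t', subspace_le (q beta) VF t' k -> forall i, (i < k)%N -> ms i <= t'].
Proof.
move=> b0 t0 tk; apply: subspace_le_eigen tk => //.
- by move=> u; exact: q_form_ge0.
- by move=> u; exact: q_form_complete.
- exact: (V_form_compact mV C0 VC V_pinfty V_ninfty b0).
- exact: V_bounded.
Qed.

Lemma spectrum_finite beta (m : R) : 0 < beta -> m < 0 ->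
  ~ forall k, subspace_le (q beta) VF m k.
Proof.
move=> b0 m0; apply: subspace_le_finite => //.
- by move=> u; exact: q_form_ge0.
- by move=> u; exact: q_form_complete.
- exact: (V_form_compact mV C0 VC V_pinfty V_ninfty b0).
- exact: V_bounded.
Qed.

Lemma V_form_ae_zero u v : (\forall x \ae mu, u x = 0) -> VF u v = 0.
Proof.
move=> u0; rewrite /V_form (@Rintegral_ae _ _ (fun=> 0)) ?Rintegral_cst ?mul0r//.
- exact: Rintegrable_measurable (Rintegrable_potential mV C0 VC (L2tP _) (L2tP _)).
- by move: u0; apply: ae_sub => x ->; rewrite mulr0 mul0r.
Qed.

Lemma mass_form_eq0 u : mass_form u u = 0 -> \forall x \ae mu, u x = 0.
Proof.
rewrite /mass_form L2_ipE => /Rintegral_eq0 h.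
have := h (L2_integrable_sqr (L2tP _)) (fun x => sqr_ge0 _).
by apply: ae_sub => x /eqP; rewrite sqrf_eq0 => /eqP.
Qed.

(** If [u] vanishes almost everywhere then so does [VF u], and the eigenvalue relation gives m q(u,
    u) = 0; the stored derivative need not be examined. *)
Lemma eigen_ae_neq0 beta m u : form_eigen (q beta) VF m u -> m != 0 -> q beta u u != 0 ->
  ~ ae_zero u.
Proof.
move=> ue m0 q0 u0; have := ue u; rewrite (V_form_ae_zero u u0) => /esym/eqP.
by rewrite mulf_eq0 (negbTE m0) (negbTE q0).
Qed.

(** Forward, [eigen_lincomb_le] extends the bound from the eigenfunctions to their span; backward,
    the spectral family supplies the eigenfunctions. *)
Lemma neg_countP beta (t : R) j : 0 < beta -> t < 0 ->
  neg_count_ge V beta t j <-> subspace_le (q beta) VF t j.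
Proof.
move=> b0 t0; split=> [[f [fi fe]]|tj].
  have /choice[U UP] : forall i : 'I_j, exists um : H1t * R,
      [/\ L2_fun (H1_val um.1) = f i, um.2 <= t & form_eigen (q beta) VF um.2 um.1].
    by move=> i; have [m [m0 [mt /KeigP[u uf ue]]]] := fe i; exists (u, m).
  pose e n := if insub n is Some i then (U i).1 else 0.
  pose ms n := if insub n is Some i then (U i).2 else 0.
  have eE (i : 'I_j) : e i = (U i).1 by rewrite /e valK.
  have mE (i : 'I_j) : ms i = (U i).2 by rewrite /ms valK.
  exists e; split; last first.
    move=> c; apply: (eigen_lincomb_le (qB beta) VB _ _ (ms := ms)).
    - by move=> u; exact: q_form_ge0.
    - by move=> i ij; rewrite (mE (Ordinal ij)) (eE (Ordinal ij)); case: (UP (Ordinal ij)).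
    - by move=> i ij; rewrite (mE (Ordinal ij)); case: (UP (Ordinal ij)).
  move=> c c0 i ij.
  have m0 : mass_form (lincomb j c e) (lincomb j c e) = 0.
    apply/le_anti; rewrite mass_form_ge0 andbT -(pmulr_rle0 _ b0) -c0.
    by rewrite lerDr; exact: energy_form_ge0.
  apply: (fi (fun i : 'I_j => c i) _ (Ordinal ij)).
  have := mass_form_eq0 m0; apply: ae_sub => x; rewrite lincomb_H1; apply: etrans.
  by apply: eq_bigr => k _; rewrite eE; case: (UP k) => <-.
have [e [ms [eo ee em]]] := spectral_family b0 t0 tj.
exists (fun i : 'I_j => L2_fun (H1_val (e i))); split; last first.
  move=> i; exists (ms i); have mt := em t tj i (ltn_ord i).
  split; first exact: le_lt_trans t0.
  by split => //; apply/KeigP; exists (e i) => //; exact: ee.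
move=> c c0 i.
pose c' n := if insub n is Some i then c i else 0.
have cE (k : 'I_j) : c' k = c k by rewrite /c' valK.
have w0 : \forall x \ae mu, L2_fun (H1_val (lincomb j c' e)) x = 0.
  move: c0; apply: ae_sub => x; rewrite lincomb_H1; apply: etrans.
  by apply: eq_bigr => k _; rewrite cE.
have mi0 : ms i < 0 by exact: le_lt_trans (em t tj i (ltn_ord i)) t0.
(* The combination is zero almost everywhere, hence killed by [VF]. As [ms i] is nonzero, it is then
   [q]-orthogonal to [e i], and this inner product is the coefficient [c i]. *)
have : ms i * q beta (e i) (lincomb j c' e) = 0.
  by rewrite -ee// (formC VB) V_form_ae_zero.
move=> /eqP; rewrite mulf_eq0 lt_eqF//= => /eqP <-.
rewrite /lincomb (form_sumr (qB beta)) (bigD1 i)//= (formZr (qB beta)) eo// eqxx mulr1 cE.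
rewrite big1 ?addr0// => k; rewrite eq_sym -val_eqE/= (formZr (qB beta)) eo// => /negbTE ->.
by rewrite mulr0.
Qed.

End eigenvalues.

(** * The eigenvalue branches mu_j *)

Section eigenvalue_branches.
Context {R : realType}.
Local Notation mu := (@lebesgue_measure R).
Implicit Types (u v : @H1t R) (t beta : R).
Variables (V : R -> R) (C : R).
Hypothesis mV : measurable_fun setT V.
Hypothesis C0 : 0 <= C.
Hypothesis VC : \forall x \ae mu, `|V x| <= C.
Hypothesis V_pinfty : V x @[x --> +oo] --> 0.
Hypothesis V_ninfty : V x @[x --> -oo] --> 0.

Local Notation q := (@q_form R).
Local Notation VF := (V_form V).
Let qB beta : sym_bilinear (q beta) := q_form_sym_bilinear beta.
Let VB : sym_bilinear VF := V_form_sym_bilinear mV C0 VC.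
Let neg_countP := neg_countP mV C0 VC V_pinfty V_ninfty.

(** The infimum defining [mu_j] is attained: the largest eigenvalue of the spectral family is
    admissible, and extremality of the family makes it a lower bound. *)
Lemma mu_j_spec j beta : (0 < j)%N -> 0 < beta ->
  (exists t, t < 0 /\ neg_count_ge V beta t j) ->
  [/\ mu_j V j beta < 0, neg_count_ge V beta (mu_j V j beta) j,
      forall t, t < 0 -> neg_count_ge V beta t j -> mu_j V j beta <= t &
      exists u, form_eigen (q beta) VF (mu_j V j beta) u /\ q beta u u = 1].
Proof.
case: j => // j _ b0 [t [t0 tj]].
have [e [ms [eo ee em]]] := spectral_family mV C0 VC V_pinfty V_ninfty b0 t0
  ((neg_countP j.+1 b0 t0).1 tj).
pose i0 := [arg max_(i > (ord0 : 'I_j.+1)) ms i]%O.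
have ms_le i : (i < j.+1)%N -> ms i <= ms i0.
  move=> ij; rewrite /i0; case: Order.TotalTheory.arg_maxP => // i1 _ h.
  exact: (h (Ordinal ij)).
have m0 : ms i0 < 0.
  by apply: (le_lt_trans _ t0); apply: em => //; exact/(neg_countP _ b0 t0).
have mc : neg_count_ge V beta (ms i0) j.+1.
  apply/neg_countP => //; apply: (eigen_subspace_le (qB beta) VB _ eo ee ms_le).
  by move=> u; exact: q_form_ge0.
have ml t' : t' < 0 -> neg_count_ge V beta t' j.+1 -> ms i0 <= t'.
  by move=> t'0 /neg_countP; move=> /(_ b0 t'0) h; apply: em.
have -> : mu_j V j.+1 beta = ms i0.
  apply/le_anti/andP; split.
    apply: ge_inf; last by split.
    by exists (ms i0) => t' [t'0 ?]; exact: ml.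
  by apply: lb_le_inf; [exists (ms i0)|move=> t' [? ?]; exact: ml].
split=> //; exists (e i0); split; first exact: ee.
by rewrite eo// eqxx.
Qed.

Lemma neg_count_mono j beta beta' t : 0 < beta -> beta <= beta' -> t < 0 ->
  neg_count_ge V beta' t j -> neg_count_ge V beta t j.
Proof.
move=> b0 bb t0; have b'0 := lt_le_trans b0 bb.
have qle u : q beta u u <= q beta' u u.
  by rewrite lerD2l ler_wpM2r// mass_form_ge0.
move=> /(neg_countP j b'0 t0)[f [fi fb]]; apply/neg_countP => //; exists f; split.
  move=> c c0; apply: fi; apply/le_anti; rewrite q_form_ge0// andbT.
  have : energy_form (lincomb j c f) (lincomb j c f) <= 0.
    by rewrite -c0 lerDl mulr_ge0 ?mass_form_ge0// ltW.
  have : beta * mass_form (lincomb j c f) (lincomb j c f) <= 0.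
    by rewrite -c0 lerDr energy_form_ge0.
  rewrite pmulr_rle0// => h1 h2; rewrite /q_form -[0]addr0; apply: lerD => //.
  by rewrite pmulr_rle0.
by move=> c; apply: le_trans (fb c) _; rewrite ler_nM2l.
Qed.

Lemma neg_count_scale j beta beta' t : 0 < beta -> beta <= beta' -> t < 0 ->
  neg_count_ge V beta t j -> neg_count_ge V beta' (beta / beta' * t) j.
Proof.
move=> b0 bb t0; have b'0 := lt_le_trans b0 bb.
have r0 : 0 < beta / beta' by rewrite divr_gt0.
have qle u : beta / beta' * q beta' u u <= q beta u u.
  rewrite /q_form mulrDr mulrA divfK ?gt_eqF// lerD2r.
  by rewrite ler_piMl ?energy_form_ge0// ler_pdivrMr// mul1r.
have t'0 : beta / beta' * t < 0 by rewrite pmulr_rlt0.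
move=> /(neg_countP j b0 t0)[f [fi fb]]; apply/neg_countP => //; exists f; split.
  move=> c c0; apply: fi; apply/le_anti; rewrite q_form_ge0// andbT.
  have : energy_form (lincomb j c f) (lincomb j c f) <= 0.
    by rewrite -c0 lerDl mulr_ge0 ?mass_form_ge0// ltW.
  have : beta' * mass_form (lincomb j c f) (lincomb j c f) <= 0.
    by rewrite -c0 lerDr energy_form_ge0.
  rewrite pmulr_rle0// => h1 h2; rewrite /q_form -[0]addr0; apply: lerD => //.
  by rewrite pmulr_rle0.
move=> c; apply: le_trans (fb c) _.
have := qle (lincomb j c f); move: (q beta _ _) (q beta' _ _) => x y xy.
by rewrite (_ : beta / beta' * t * y = t * (beta / beta' * y)) ?ler_nM2l//; ring.
Qed.

(** The index set does not depend on beta: a negative level passes unchanged to smaller beta and,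
    rescaled, to larger beta. *)
Lemma neg_count_N_minus j beta t : (0 < j)%N -> 0 < beta -> t < 0 ->
  neg_count_ge V beta t j -> N_minus V j.
Proof.
move=> j0 b0 t0 tj; split => // beta' b'0.
have [bb|/ltW bb] := leP beta beta'.
  exists (beta / beta' * t); split; last exact: neg_count_scale.
  by rewrite pmulr_rlt0// divr_gt0.
by exists t; split => //; exact: neg_count_mono tj.
Qed.

Section branch.
Variable j : nat.
Hypothesis jN : N_minus V j.

Let spec beta (b0 : 0 < beta) := mu_j_spec jN.1 b0 (jN.2 beta b0).

Lemma mu_j_lt0 beta : 0 < beta -> mu_j V j beta < 0.
Proof. by move=> /spec[]. Qed.

Lemma mu_j_mono beta beta' : 0 < beta -> beta <= beta' ->
  mu_j V j beta <= mu_j V j beta'.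
Proof.
move=> b0 bb; have [m0 mc _ _] := spec (lt_le_trans b0 bb).
have [_ _ ml _] := spec b0; apply: ml => //.
exact: neg_count_mono mc.
Qed.

Lemma mu_j_scale beta beta' : 0 < beta -> beta <= beta' ->
  beta' * mu_j V j beta' <= beta * mu_j V j beta.
Proof.
move=> b0 bb; have b'0 := lt_le_trans b0 bb.
have [m0 mc _ _] := spec b0; have [_ _ ml _] := spec b'0.
have := ml _ _ (neg_count_scale b0 bb m0 mc); rewrite pmulr_rlt0 ?divr_gt0// => /(_ m0).
by rewrite mulrAC ler_pdivlMr// mulrC.
Qed.

(** For a normalized eigenfunction, - s mass(u) <= VF(u, u) = m q(u, u) <= m beta mass(u); divide by
    the mass. The case [s = 1] selects the root, the essential supremum gives the bound in (c). *)
Lemma mu_j_lower (s : R) beta : (\forall x \ae mu, - V x <= s) -> 0 < beta ->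
  - (beta * mu_j V j beta) <= s.
Proof.
move=> Vs b0; have [m0 _ _ [u [ue uq]]] := spec b0.
set m := mu_j V j beta in m0 ue *.
have mass0 : 0 < mass_form u u.
  rewrite lt_neqAle mass_form_ge0 andbT; apply/eqP => /esym um.
  have : m * q beta u u = 0 by rewrite -ue (V_form_ae_zero mV C0 VC) //; exact: mass_form_eq0.
  by rewrite uq mulr1 => /eqP; rewrite lt_eqF.
have h1 : - s * mass_form u u <= VF u u.
  rewrite /mass_form L2_ipE -RintegralZl//; last exact: L2_integrable_sqr (L2tP _).
  apply: Rintegral_le_ae.
  - by apply: RintegrableZ; exact: L2_integrable_sqr (L2tP _).
  - exact: (Rintegrable_potential mV C0 VC (L2tP u) (L2tP u)).
  - move: Vs; apply: ae_sub => x Vx.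
    by rewrite -mulrA -expr2 ler_wpM2r ?sqr_ge0// lerNl.
have h2 : VF u u <= m * (beta * mass_form u u).
  by rewrite ue ler_nM2l// lerDr energy_form_ge0.
rewrite -(ler_pM2r mass0); lra.
Qed.

End branch.

Lemma mu_j_index_mono i j beta : N_minus V i -> N_minus V j -> (i <= j)%N -> 0 < beta ->
  mu_j V i beta <= mu_j V j beta.
Proof.
move=> iN jN ij b0.
have [m0 mc _ _] := mu_j_spec jN.1 b0 (jN.2 beta b0).
have [_ _ ml _] := mu_j_spec iN.1 b0 (iN.2 beta b0); apply: ml => //.
have h := (neg_countP j b0 m0).1 mc; apply/neg_countP => //.
exact: subspace_le_widen ij h.
Qed.

(** By monotonicity the one-sided limit is an infimum, so a strict bound on [mu_j0] is witnessed at
    some beta. *)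
Lemma mu_j0E j : N_minus V j ->
  mu_j0 V j = ereal_inf [set (mu_j V j b)%:E | b in `]0, +oo[].
Proof.
move=> jN; apply: cvg_lim => //.
apply: (@nondecreasing_at_right_cvge _ (fun b => (mu_j V j b)%:E) 0 +oo%O) => //.
move=> b b'; rewrite !in_itv/= !andbT => b0 b'0 bb.
by rewrite lee_fin; exact: mu_j_mono.
Qed.

Lemma mu_j0_lt j (c : R) : N_minus V j -> (mu_j0 V j < c%:E)%E ->
  exists2 beta, 0 < beta & mu_j V j beta < c.
Proof.
move=> jN; rewrite mu_j0E// => /ereal_inf_lt[y [b /=]].
by rewrite in_itv/= andbT => b0 <-; rewrite lte_fin; exists b.
Qed.

Lemma mu_j0_le j beta : N_minus V j -> 0 < beta -> (mu_j0 V j <= (mu_j V j beta)%:E)%E.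
Proof.
move=> jN b0; rewrite mu_j0E//; apply: ereal_inf_lbound.
by exists beta => //=; rewrite in_itv/= b0.
Qed.

(** Let [k] be the largest dimension on which [b] stays below some level strictly under [m]; it
    exists since the spectrum below [m] is finite. Adding [u] to the [k] eigenvectors found there
    gives mu_(k+1) <= m, and strict inequality would contradict maximality. *)
Lemma eigenvalue_index beta m u : 0 < beta -> m < 0 ->
  form_eigen (q beta) VF m u -> ~ ae_zero u ->
  exists2 j, N_minus V j & mu_j V j beta = m.
Proof.
move=> b0 m0 ue une.
have q0 v : 0 <= q beta v v by exact: q_form_ge0.
have /existsNP[K mK] := spectrum_finite mV C0 VC V_pinfty V_ninfty b0 m0.
pose P k := `[< exists2 t, t < m & subspace_le (q beta) VF t k >].
have le_t k t t' : t <= t' -> subspace_le (q beta) VF t k -> subspace_le (q beta) VF t' k.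
  move=> tt [f [fi fb]]; exists f; split => // c; apply: le_trans (fb c) _.
  exact: ler_wpM2r.
have PK k : P k -> (k <= K)%N.
  move=> /asboolP[t tm tk]; rewrite leqNgt; apply/negP => Kk; apply: mK.
  exact: subspace_le_widen (ltnW Kk) (le_t _ _ _ (ltW tm) tk).
have P0 : exists k, P k.
  exists 0%N; apply/asboolP; exists (m - 1); first by rewrite ltrBlDr ltrDl.
  exists (fun=> 0); split => // c.
  by rewrite /lincomb big_ord0 (form0l VB) (form0l (qB beta)) mulr0.
case: (ex_maxnP P0 PK) => k /asboolP[t tm tk] kmax.
have t0 : t < 0 by exact: lt_trans m0.
have [e [ms [eo ee em]]] := spectral_family mV C0 VC V_pinfty V_ninfty b0 t0 tk.
have uq : 0 < q beta u u.
  rewrite lt_neqAle q0 andbT; apply/eqP => /esym quu; apply: une.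
  apply: mass_form_eq0; apply/le_anti; rewrite mass_form_ge0 andbT -(pmulr_rle0 _ b0) -quu.
  by rewrite lerDr energy_form_ge0.
pose w := (Num.sqrt (q beta u u))^-1 *: u.
have we : form_eigen (q beta) VF m w.
  by move=> v; rewrite (formZl VB) (formZl (qB beta)) ue mulrCA.
have w1 : q beta w w = 1.
  rewrite (formZl (qB beta)) (formZr (qB beta)) mulrA -expr2 exprVn sqr_sqrtr//.
  by rewrite mulVf// gt_eqF.
have wo : orth (q beta) k e w.
  move=> i ik; apply: (eigen_orthogonal (qB beta) VB we (ee i ik)).
  by rewrite gt_eqF// (le_lt_trans (em t tk i ik)).
have mj : neg_count_ge V beta m k.+1.
  apply/neg_countP => //.
  apply: (eigen_subspace_le (qB beta) VB q0 (e := extend k e w) (ms := extend k ms m)).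
  - exact: orthonormal_extend.
  - move=> i; rewrite ltnS /extend; case: eqVneq => [//|ik ik'].
    by apply: ee; rewrite ltn_neqAle ik.
  - move=> i; rewrite ltnS /extend; case: eqVneq => [//|ik ik'].
    by apply: le_trans (ltW tm); apply: em => //; rewrite ltn_neqAle ik.
exists k.+1; first exact: neg_count_N_minus mj.
have [n0 nc nl _] := mu_j_spec (ltn0Sn k) b0 (ex_intro _ m (conj m0 mj)).
apply/eqP; rewrite eq_le nl//= leNgt; apply/negP => nm.
have := kmax k.+1; rewrite ltnn => /(_ _)/negP; apply => //.
by apply/asboolP; exists (mu_j V k.+1 beta) => //; exact/neg_countP.
Qed.

End eigenvalue_branches.

(** * The scalar fixed-point equation for beta *)

Section fixed_points.
Context {R : realType}.
Implicit Types (a b l m n x y : R).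

Lemma lipschitz_within_continuous (f : R -> R) a b (K : R) :
  (forall x y, a <= x -> x <= y -> y <= b -> `|f x - f y| <= K * (y - x)) ->
  {within `[a, b], continuous f}.
Proof.
move=> fK; have fK' x y : x \in `[a, b] -> y \in `[a, b] -> `|f x - f y| <= `|K| * `|x - y|.
  rewrite !in_itv/= => /andP[ax xb] /andP[ay yb].
  have [xy|/ltW yx] := leP x y.
    apply: le_trans (fK _ _ ax xy yb) _; rewrite distrC [`|y - x|]ger0_norm ?subr_ge0//.
    by rewrite ler_wpM2r ?subr_ge0// ler_norm.
  rewrite distrC; apply: le_trans (fK _ _ ay yx xb) _; rewrite [`|x - y|]ger0_norm ?subr_ge0//.
  by rewrite ler_wpM2r ?subr_ge0// ler_norm.
apply/subspace_continuousP => x xI; apply/cvgrPdist_le => e e0.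
have K1 : 0 < `|K| + 1 by rewrite ltr_wpDl.
have eK : 0 < e / (`|K| + 1) by rewrite divr_gt0.
apply: (@filterS _ (nbhs x) _ (ball x (e / (`|K| + 1)))); last exact: nbhsx_ballx.
move=> y; rewrite /ball/= ltr_pdivlMr// => /ltW h yI.
apply: le_trans (fK' _ _ xI yI) _; apply: le_trans h.
by rewrite mulrC ler_wpM2l// lerDl.
Qed.

(* for a fixed point, [l = 1 + 1 / m] solves [b = 1 - l ^+ 2]; the bound on
   [- (b * m)] selects the root [l <= 0] *)
Lemma fixed_point_lambda b m : m < 0 -> 0 < b -> - (b * m) <= 1 ->
  b = - (1 / m) * (2 + 1 / m) ->
  [/\ 1 + 1 / m + 1 = - (b * m), 0 < 1 + 1 / m + 1, 1 + 1 / m <= 0,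
      b = 1 - (1 + 1 / m) ^+ 2 & m = - (1 - (1 + 1 / m))^-1].
Proof.
move=> m0 b0 bm be; have mn0 : m != 0 by rewrite lt_eqF.
have e : 1 + 1 / m + 1 = - (b * m) by rewrite be; field.
have bm0 : 0 < - (b * m) by rewrite -mulrN mulr_gt0// oppr_gt0.
split=> //; first by rewrite e.
- by have := bm; rewrite -e; lra.
- by rewrite [LHS]be; field.
- by field; rewrite mn0 /=; apply/eqP; lra.
Qed.

(** On ]-1, 0] the map l -> 1 - l^2 is increasing. If l1 < l2 then b1 <= b2, so m1(b1) <= m2(b1) <=
    m2(b2) < 0, and inverting gives l2 <= l1. With m1 = m2 this also yields uniqueness of the fixed
    point. *)
Lemma fixed_point_le (m1 m2 : R -> R) b1 b2 :
  (forall b, 0 < b -> m1 b < 0) -> (forall b, 0 < b -> m2 b < 0) ->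
  (forall b b', 0 < b -> b <= b' -> m2 b <= m2 b') ->
  (forall b, 0 < b -> m1 b <= m2 b) ->
  (forall b, 0 < b -> - (b * m1 b) <= 1) -> (forall b, 0 < b -> - (b * m2 b) <= 1) ->
  0 < b1 -> b1 = - (1 / m1 b1) * (2 + 1 / m1 b1) ->
  0 < b2 -> b2 = - (1 / m2 b2) * (2 + 1 / m2 b2) ->
  1 + 1 / m2 b2 <= 1 + 1 / m1 b1.
Proof.
move=> m10 m20 m2_mono m12 m1b m2b b10 e1 b20 e2.
have [_ p1 l1 be1 _] := fixed_point_lambda (m10 _ b10) b10 (m1b _ b10) e1.
have [_ p2 l2 be2 _] := fixed_point_lambda (m20 _ b20) b20 (m2b _ b20) e2.
rewrite leNgt; apply/negP => l12.
have bb : b1 <= b2.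
  rewrite be1 be2; move: l1 l2 p1 p2 l12.
  by move: (1 + 1 / m1 b1) (1 + 1 / m2 b2) => x y *; nra.
have := le_trans (m12 _ b10) (m2_mono _ _ b10 bb).
move: l12; rewrite ltrD2l !div1r => h1 h2.
have := lef_nV2; rewrite /= => inv.
have : (m2 b2)^-1 <= (m1 b1)^-1 by rewrite lef_nV2 ?negrE ?m10 ?m20.
by rewrite leNgt h1.
Qed.

(** With n = - 1 / m the equation reads b = n(b) (2 - n(b)), where n is nondecreasing, n(b) / b is
    nonincreasing and n(b) >= b. At b = 1 the difference of the two sides is at least (1 -
    n(1))^2. *)
Lemma fixed_point_exists (m : R -> R) :
  (forall b, 0 < b -> m b < 0) ->
  (forall b b', 0 < b -> b <= b' -> m b <= m b') ->
  (forall b b', 0 < b -> b <= b' -> b' * m b' <= b * m b) ->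
  (forall b, 0 < b -> - (b * m b) <= 1) ->
  (exists2 b, 0 < b & m b < - (1 / 2)) ->
  exists b, 0 < b <= 1 /\ b = - (1 / m b) * (2 + 1 / m b).
Proof.
move=> m0 m_mono m_scale mb [b1 b10 mb1].
pose n b := - (m b)^-1.
have n0 b : 0 < b -> 0 < n b by move=> b0; rewrite oppr_gt0 invr_lt0 m0.
have n_mono b b' : 0 < b -> b <= b' -> n b <= n b'.
  move=> b0 bb; rewrite lerN2 lef_nV2 ?negrE ?m0//; first exact: m_mono.
  exact: lt_le_trans bb.
have n_scale b b' : 0 < b -> b <= b' -> b * n b' <= b' * n b.
  move=> b0 bb; have b'0 := lt_le_trans b0 bb.
  have e1 : b' * m b' * (n b * n b') = - (b' * n b).
    by rewrite /n; field; rewrite !lt_eqF ?m0.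
  have e2 : b * m b * (n b * n b') = - (b * n b').
    by rewrite /n; field; rewrite !lt_eqF ?m0.
  rewrite -lerN2 -e1 -e2 ler_pM2r; first exact: m_scale.
  by rewrite mulr_gt0 ?n0.
have n_ge b : 0 < b -> b <= n b.
  move=> b0; have nb := n0 b b0; rewrite -[leRHS]mul1r.
  have e : b = - (b * m b) * n b by rewrite /n; field; rewrite lt_eqF ?m0.
  by rewrite [leLHS]e ler_pM2r// mb.
have n_lt2 : n b1 < 2.
  have h : m b1 < - 2^-1 by rewrite -[X in - X]div1r.
  by rewrite /n ltrNl -[X in X < _]invrK ltf_nV2 ?negrE ?m0 ?invr_lt0 ?oppr_lt0// invrN.
(* Chosen so that [h b0 <= 0]: if n(b0) <= 1 then n (2 - n) >= n >= b0, and otherwise n (2 - n) >= 2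
   - n >= 2 - n(b1) >= b0. *)
pose b0 := Num.min (Num.min b1 1) (2 - n b1).
have b00 : 0 < b0 by rewrite !lt_min b10 ltr01 subr_gt0.
have b0b1 : b0 <= b1 by rewrite /b0 !ge_min lexx.
have b0le1 : b0 <= 1 by rewrite /b0 !ge_min lexx !orbT.
have b0n : b0 <= 2 - n b1 by rewrite /b0 !ge_min lexx !orbT.
pose h b := b - n b * (2 - n b).
have hb0 : h b0 <= 0.
  have h1 := n_mono _ _ b00 b0b1; have h2 := n_ge _ b00; have h3 := n0 _ b00.
  rewrite /h subr_le0; have [n1|n1] := leP (n b0) 1; nra.
have h1 : 0 <= h 1 by have := sqr_ge0 (1 - n 1); rewrite /h; nra.
have hc : {within `[b0, 1], continuous h}.
  pose N := n 1.
  (* From x n(y) <= y n(x) one gets n(y) - n(x) <= (N / b0) (y - x); the factor 2 - n(x) - n(y) is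
     at most 2 + 2N in absolute value, and the term b itself contributes 1. *)
  apply: (@lipschitz_within_continuous _ _ _ (1 + N / b0 * (2 + 2 * N))) => x y bx xy y1.
  have x0 := lt_le_trans b00 bx; have y0 := lt_le_trans x0 xy.
  have nx := n0 _ x0; have nxy := n_mono _ _ x0 xy; have ny1 := n_mono _ _ y0 y1.
  have d : n y - n x <= N / b0 * (y - x).
    rewrite mulrAC ler_pdivlMr//.
    have := n_scale _ _ x0 xy; rewrite -/N in ny1; nra.
  rewrite -/N in ny1.
  have -> : h x - h y = (n y - n x) * (2 - n x - n y) - (y - x) by rewrite /h; ring.
  apply: le_trans (ler_normB _ _) _.
  rewrite normrM [`|y - x|]ger0_norm ?subr_ge0// [`|n y - n x|]ger0_norm ?subr_ge0//.
  rewrite [leRHS]mulrDl mul1r [leLHS]addrC lerD2l.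
  rewrite mulrAC; apply: ler_pM => //; first by rewrite subr_ge0.
  by rewrite ler_norml; apply/andP; split; lra.
have [c cI hc0] : exists2 c, c \in `[b0, 1] & h c = 0.
  by apply: IVT => //; rewrite ge_min hb0/= le_max h1 orbT.
move: cI; rewrite in_itv/= => /andP[bc c1]; have c0 := lt_le_trans b00 bc.
exists c; rewrite c0 c1; split => //.
by move/eqP: hc0; rewrite /h subr_eq0 => /eqP e; rewrite [LHS]e /n; field; rewrite lt_eqF ?m0.
Qed.

End fixed_points.

(** * The nonlinear eigenvalue problem *)

Theorem theorem3p2 (R : realType) (V : R -> R) :
  measurable_fun setT V ->
  (ess_sup (@lebesgue_measure R) (fun x => (`|V x|)%:E) < +oo)%E ->
  V x @[x --> +oo] --> 0 ->
  V x @[x --> -oo] --> 0 ->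
  (ess_sup (@lebesgue_measure R) (fun x => (Vneg V x)%:E) <= 1)%E ->
  (* (a) *)
  (forall j, N_minus0 V j ->
     exists! b : R, (0 < b <= 1) /\
       b = - (1 / mu_j V j b) * (2 + 1 / mu_j V j b)) /\
  exists beta : nat -> R,
    (forall j, N_minus0 V j ->
       (0 < beta j <= 1) /\
       beta j = - (1 / mu_j V j (beta j)) * (2 + 1 / mu_j V j (beta j))) /\
    let lam := fun j => 1 + 1 / mu_j V j (beta j) in
    (* (b) *)
    [set l | -1 < l < 1 /\ exists phi, ~ ae_zero phi /\ solves_ast V l phi]
      = lam @` (N_minus0 V) /\
    (forall j, N_minus0 V j -> -1 < lam j < 1) /\
    (forall j, N_minus0 V j ->
       [set phi | solves_ast V (lam j) phi]
         = [set u | Keig V (beta j) (mu_j V j (beta j)) u]) /\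
    (* (c) *)
    (forall i j, N_minus0 V i -> N_minus0 V j -> (i <= j)%N -> lam j <= lam i) /\
    (forall j, N_minus0 V j ->
       0 < lam j + 1 /\
       ((lam j + 1)%:E <= ess_sup (@lebesgue_measure R) (fun x => (Vneg V x)%:E))%E).
Proof.
move=> mV Vfin V_pinfty V_ninfty Vneg1.
have [C [C0 VC]] : exists C : R, 0 <= C /\ \forall x \ae (@lebesgue_measure R), `|V x| <= C.
  have := ess_sup_ge (@lebesgue_measure R) (fun x => (`|V x|)%:E).
  case: (ess_sup _ _) Vfin => [r| |] // _ h.
    exists `|r|; split => //; move: h; apply: ae_sub => x; rewrite lee_fin => h.
    by rewrite (le_trans h)// ler_norm.
  by exists 0; split => //; move: h; apply: ae_sub => x; rewrite leeNy_eq.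
have Vneg_le (s : R) x : ((Vneg V x)%:E <= s%:E)%E -> - V x <= s.
  by rewrite lee_fin /Vneg ge_max => /andP[].
have Vle1 : \forall x \ae (@lebesgue_measure R), - V x <= 1.
  by move/ess_supP: Vneg1; apply: ae_sub => x; exact: Vneg_le.
have lt0 j := mu_j_lt0 mV C0 VC V_pinfty V_ninfty (j := j).
have mono j := mu_j_mono mV C0 VC V_pinfty V_ninfty (j := j).
have lower j := mu_j_lower mV C0 VC V_pinfty V_ninfty (j := j).
have index_mono := mu_j_index_mono mV C0 VC V_pinfty V_ninfty.
have fp_le i j b1 b2 : N_minus0 V i -> N_minus0 V j -> (i <= j)%N ->
    0 < b1 -> b1 = - (1 / mu_j V i b1) * (2 + 1 / mu_j V i b1) ->
    0 < b2 -> b2 = - (1 / mu_j V j b2) * (2 + 1 / mu_j V j b2) ->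
    1 + 1 / mu_j V j b2 <= 1 + 1 / mu_j V i b1.
  move=> [iN _] [jN _] ij b10 e1 b20 e2.
  apply: (@fixed_point_le _ (mu_j V i) (mu_j V j)) => // b.
  - exact: lt0.
  - exact: lt0.
  - by move=> b' b0 bb; exact: mono.
  - exact: index_mono.
  - exact: lower.
  - exact: lower.
have fp_unique j b1 b2 : N_minus0 V j ->
    0 < b1 -> b1 = - (1 / mu_j V j b1) * (2 + 1 / mu_j V j b1) ->
    0 < b2 -> b2 = - (1 / mu_j V j b2) * (2 + 1 / mu_j V j b2) -> b1 = b2.
  move=> jN b10 e1 b20 e2.
  have [_ _ _ -> _] := fixed_point_lambda (lt0 j jN.1 _ b10) b10 (lower j jN.1 _ _ Vle1 b10) e1.
  have [_ _ _ -> _] := fixed_point_lambda (lt0 j jN.1 _ b20) b20 (lower j jN.1 _ _ Vle1 b20) e2.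
  (* Both fixed points are determined by their lambda, and [fp_le] with equal indices compares these
     in both directions. *)
  congr (1 - _ ^+ 2); apply/le_anti/andP.
  by split; apply: fp_le.
have fp_ex j : N_minus0 V j -> exists b, 0 < b <= 1 /\
    b = - (1 / mu_j V j b) * (2 + 1 / mu_j V j b).
  move=> [jN j0]; apply: fixed_point_exists.
  - exact: lt0.
  - by move=> b b' b0 bb; exact: mono.
  - by move=> b b'; exact: (mu_j_scale mV C0 VC V_pinfty V_ninfty).
  - by move=> b; exact: lower.
  - exact: (mu_j0_lt mV C0 VC V_pinfty V_ninfty jN j0).
split.
  move=> j jN; have [b [b01 be]] := fp_ex j jN; exists b; split=> // b' [b'01 b'e].
  have /andP[b0 _] := b01; have /andP[b'0 _] := b'01.
  exact: (fp_unique j).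
have /choice[beta betaP] : forall j, exists b, N_minus0 V j ->
    0 < b <= 1 /\ b = - (1 / mu_j V j b) * (2 + 1 / mu_j V j b).
  (* Outside [N_minus0] the value 0 is a placeholder. *)
  move=> j; have [jN|] := pselect (N_minus0 V j); last by exists 0.
  by have [b bP] := fp_ex j jN; exists b.
exists beta; split => // lam.
have spec j : N_minus0 V j -> [/\ lam j + 1 = - (beta j * mu_j V j (beta j)),
    0 < lam j + 1, lam j <= 0, beta j = 1 - lam j ^+ 2 &
    mu_j V j (beta j) = - (1 - lam j)^-1].
  move=> jN; have [/andP[b0 _] be] := betaP j jN.
  exact: fixed_point_lambda (lt0 j jN.1 _ b0) b0 (lower j jN.1 _ _ Vle1 b0) be.
have lam_itv j : N_minus0 V j -> -1 < lam j < 1.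
  move=> jN; have [_ h1 h2 _ _] := spec j jN; apply/andP; split; lra.
have eigenspace j phi : N_minus0 V j ->
    solves_ast V (lam j) phi <-> Keig V (beta j) (mu_j V j (beta j)) phi.
  move=> jN; have [_ _ l0 e1 e2] := spec j jN.
  by rewrite e2 [beta j in X in _ <-> X]e1; apply: solves_ast_Keig; lra.
split.
  apply/seteqP; split=> l.
    move=> [/andP[l1 l2] [phi [phi0 /solves_ast_Keig]]] => /(_ l2)/KeigP[u uphi ue].
    rewrite -uphi in phi0.
    have b0 : 0 < 1 - l ^+ 2 by nra.
    have m0 : - (1 - l)^-1 < 0 by rewrite oppr_lt0 invr_gt0 subr_gt0.
    have [j jN jm] := eigenvalue_index mV C0 VC V_pinfty V_ninfty b0 m0 ue phi0.
    have jN0 : N_minus0 V j.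
      (* Since l > -1, the eigenvalue - 1 / (1 - l) lies below - 1/2, and the limit at 0 lies below
         every value of the branch. *)
      split => //; apply: le_lt_trans (mu_j0_le mV C0 VC V_pinfty V_ninfty jN b0) _.
      rewrite jm lte_fin ltrN2 div1r ltf_pV2 ?posrE//; lra.
    have [/andP[bj0 _] be] := betaP j jN0.
    have l1' : 1 - l != 0 by rewrite subr_eq0 gt_eqF.
    (* [1 - l ^+ 2] solves the equation that characterizes [beta j], so uniqueness identifies the
       two. *)
    have bl : 1 - l ^+ 2 = beta j.
      by apply: (fp_unique j) => //; rewrite jm; field.
    by exists j => //; rewrite /lam -bl jm; field.
  move=> [j jN <-]; split; first exact: lam_itv.
  have [/andP[b0 _] be] := betaP j jN.
  have [m0 _ _ [u [ue uq]]] := mu_j_spec mV C0 VC V_pinfty V_ninfty jN.1.1 b0 (jN.1.2 _ b0).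
  exists u; split.
    apply: (eigen_ae_neq0 mV C0 VC ue); first by rewrite lt_eqF.
    by rewrite uq oner_neq0.
  by apply/eigenspace => //; apply/KeigP; exists u.
split => //; split.
  by move=> j jN; apply/seteqP; split=> phi /=; move/(eigenspace j phi jN).
split.
  move=> i j iN jN ij.
  have [/andP[bi0 _] bie] := betaP i iN; have [/andP[bj0 _] bje] := betaP j jN.
  exact: fp_le.
move=> j jN; have [e l0 _ _ _] := spec j jN; split => //.
have [/andP[b0 _] _] := betaP j jN.
have := ess_sup_ge (@lebesgue_measure R) (fun x => (Vneg V x)%:E).
case: (ess_sup _ _) => [r| |] h.
- by rewrite lee_fin e; apply: lower jN.1 _ _ _ b0; move: h; apply: ae_sub => x; exact: Vneg_le.
- exact: leey.
(* The value -oo is absurd: the almost everywhere bound then yields any inequality, and -1 in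
   [mu_j_lower] would give 0 < lam j + 1 <= -1. *)
- have V1 : \forall x \ae (@lebesgue_measure R), - V x <= -1.
    by move: h; apply: ae_sub => x; rewrite leeNy_eq.
  have := lower j jN.1 _ _ V1 b0; rewrite -e => /(lt_le_trans l0).
  by rewrite oppr_gt0 ltr10.
Qed.
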